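(* Let $\mathbb{G}$ be a stratified Lie group of homogeneous dimension $Q$ and let $\Omega\subset\mathbb{G}$ be an open subset. Let $0<s<1\le p<+\infty$ and $Q<ps$. Then $X_0^{s,p}(\Omega)$ is continuously embedded into $C^{0,\alpha}(\Omega)$ for $\alpha=\frac{sp-Q}{p}$; that is, there exists a constant $C=C(Q,s,p,\Omega)>0$ such that, for every $u\in X_0^{s,p}(\Omega)$, $$\|u\|_{C^{0,\alpha}(\Omega)}\le C\,\|u\|_{X_0^{s,p}(\Omega)}.$$ Moreover, if $\Omega$ is bounded, then $X_0^{s,p}(\Omega)$ is compactly embedded into $C^{0,\beta}(\overline{\Omega})$ for every $0<\beta<\alpha$.
   Context: A stratified Lie group is $\mathbb{G}=(\mathbb{R}^N,\circ)$ with $\mathbb{R}^N=\mathbb{R}^{N_1}\times\cdots\times\mathbb{R}^{N_k}$ such that for every $\lambda>0$ the dilation $D_\lambda(x^{(1)},\dots,x^{(k)})=(\lambda x^{(1)},\lambda^2x^{(2)},\dots,\lambda^k x^{(k)})$ is a group automorphism, and such that the left-invariant vector fields $X_1,\dots,X_{N_1}$ with $X_j(0)=\partial/\partial x_j|_0$ generate, via iterated commutators, a Lie algebra of rank $N$ at every point. We write $\lambda x$ for $D_\lambda(x)$ and $y^{-1}x$ for $y^{-1}\circ x$. The homogeneous dimension is $Q=N_1+2N_2+\dots+kN_k$. The Haar measure $dx$ is Lebesgue measure on $\mathbb{R}^N$. A homogeneous quasi-norm $|\cdot|:\mathbb{G}\to[0,\infty)$ is fixed: it is continuous, $|x|=0$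 iff $x=0$, $|x^{-1}|=|x|$, and $|\lambda x|=\lambda|x|$ for $\lambda>0$. It is taken so that $d(x,y)=|y^{-1}x|$ is a (left-invariant, homogeneous) distance on $\mathbb{G}$. For an open set $U\subset\mathbb{G}$, the Gagliardo semi-norm is $$[u]_{s,p,U}=\left(\int_U\int_U\frac{|u(x)-u(y)|^p}{|y^{-1}x|^{Q+ps}}\,dx\,dy\right)^{1/p},$$ and $W^{s,p}(U)=\{u\in L^p(U):[u]_{s,p,U}<\infty\}$. The space $X_0^{s,p}(\Omega)$ is the completion of $C_0^\infty(\Omega)$ (functions extended by $0$ to $\mathbb{G}$) under the norm $\|u\|_{X_0^{s,p}(\Omega)}=\|u\|_{L^p(\Omega)}+[u]_{s,p,\mathbb{G}}$; its elements are functions $u\in W^{s,p}(\mathbb{G})$ with $u=0$ in $\mathbb{G}\setminus\Omega$. When $\Omega$ is bounded, a Poincaré inequality $\|u\|_{L^p(\Omega)}\le C[u]_{s,p,\mathbb{G}}$ holds on this space and $[u]_{s,p,\mathbb{G}}$ is an equivalent norm. For $0<\alpha\le1$, the Folland–Stein class $C^{0,\alpha}(\Omega)$ is the set of $u\in L^\infty(\Omega)$ with $[u]_{C^{0,\alpha}(\Omega)}:=\sup_{x,y\in\Omega,\,x\ne y}\frac{|u(x)-u(y)|}{|y^{-1}x|^\alpha}<\infty$, with norm $\|u\|_{C^{0,\alpha}(\Omega)}=\|u\|_{L^\infty(\Omega)}+[u]_{C^{0,\alpha}(\Omega)}$. Also $C^{0,\alpha}(\overline\Omega):=C^{0,\alpha}(\Omega)\cap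 C(\overline\Omega)$, with the same norm. As usual, functions are identified with their continuous representatives. *)

(* Defs.v *)
From HB Require Import structures.
From mathcomp Require Import all_boot all_order all_algebra.
From mathcomp Require Import all_classical all_reals all_analysis.
Set Implicit Arguments.
Unset Strict Implicit.
Unset Printing Implicit Defensive.
Import Order.TTheory GRing.Theory Num.Theory.
Import numFieldNormedType.Exports.
Local Open Scope classical_set_scope.
Local Open Scope ring_scope.

Fact rV_display : measure_display. Proof. exact: default_measure_display. Qed.

Section measurable_rV.
Variables (R : realType) (n : nat).

Definition rV_coord (i : 'I_n) (x : 'rV[R]_n) : R := x ord0 i.

Let rV_set0 : g_sigma_preimage rV_coord set0.
Proof. exact: sigma_algebra0. Qed.

Let rV_setC A : g_sigma_preimage rV_coord A -> g_sigma_preimage rV_coord (~` A).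
Proof. exact: sigma_algebraC. Qed.

Let rV_bigcup (F : (set 'rV[R]_n)^nat) :
  (forall i, g_sigma_preimage rV_coord (F i)) ->
  g_sigma_preimage rV_coord (\bigcup_i F i).
Proof. exact: sigma_algebra_bigcup. Qed.

HB.instance Definition _ := @isMeasurable.Build rV_display 'rV[R]_n
  (g_sigma_preimage rV_coord) rV_set0 rV_setC rV_bigcup.

Lemma measurable_rV_coord (i : 'I_n) :
  measurable_fun [set: 'rV[R]_n] (rV_coord i).
Proof.
move=> _ Y mY; rewrite setTI; apply: sub_sigma_algebra => /=.
rewrite -bigcup_seq/=; exists i => /=; first by rewrite mem_index_enum.
by exists Y => //; rewrite setTI.
Qed.

Lemma measurable_fun_rVP d (T : measurableType d) (f : T -> 'rV[R]_n) :
  (forall i, measurable_fun [set: T] (rV_coord i \o f)) ->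
  measurable_fun [set: T] f.
Proof.
move=> mf _ A mA.
have -> : [set: T] `&` f @^-1` A = f @^-1` A by rewrite setTI.
move: A mA; apply: (@smallest_sub _ _ _ [set A | measurable (f @^-1` A)]).
  split => /=; first by rewrite preimage_set0.
  - by move=> A mA; rewrite setTD preimage_setC; exact: measurableC.
  - by move=> F mF; rewrite preimage_bigcup; exact: bigcup_measurable.
rewrite -bigcup_seq/= => A [i _ [B mB <-]] /=.
rewrite setTI -[X in measurable X]setTI.
exact: mf.
Qed.

End measurable_rV.

Section lebesgue_rV_rec.
Variables (R : realType) (n : nat).
Variable mu : {sigma_finite_measure set 'rV[R]_n -> \bar R}.

Definition rV_cons (z : measurableTypeR R * 'rV[R]_n) : 'rV[R]_n.+1 :=
  row_mx (const_mx z.1 : 'rV_1) z.2.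

Lemma rV_cons0 z : rV_cons z ord0 ord0 = z.1.
Proof.
have -> : ord0 = lshift n (ord0 : 'I_1) :> 'I_n.+1 by exact: val_inj.
apply: etrans (_ : (const_mx z.1 : 'rV_1) 0 ord0 = _); last by rewrite mxE.
exact: (row_mxEl (const_mx z.1) z.2).
Qed.

Lemma rV_consS z (i : 'I_n) : rV_cons z ord0 (lift ord0 i) = z.2 ord0 i.
Proof.
have -> : lift ord0 i = rshift 1 i by exact: val_inj.
exact: (row_mxEr (const_mx z.1) z.2).
Qed.

Lemma measurable_rV_cons : measurable_fun setT rV_cons.
Proof.
apply: measurable_fun_rVP => i; have [j ->|->] := unliftP ord0 i.
- rewrite (_ : _ \o _ = rV_coord j \o snd); last first.
    by apply/funext => z; exact: rV_consS.
  exact: measurableT_comp (measurable_rV_coord j) measurable_snd.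
- rewrite (_ : _ \o _ = fst); first exact: measurable_fst.
  by apply/funext => z; exact: rV_cons0.
Qed.

Definition lebesgue_rV_S : set 'rV[R]_n.+1 -> \bar R :=
  pushforward (@lebesgue_measure R \x mu)%E rV_cons.

Let m0 : lebesgue_rV_S set0 = 0%E.
Proof. by rewrite /lebesgue_rV_S /pushforward preimage_set0 measure0. Qed.

Let m_ge0 A : (0 <= lebesgue_rV_S A)%E.
Proof. by rewrite /lebesgue_rV_S /pushforward; exact: measure_ge0. Qed.

Let m_add : semi_sigma_additive lebesgue_rV_S.
Proof.
have mc := measurable_rV_cons.
move=> F mF tF mUF; rewrite /lebesgue_rV_S /pushforward preimage_bigcup.
apply: measure_semi_sigma_additive.
- by move=> k; rewrite -[X in measurable X]setTI; exact: mc.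
- apply/trivIsetP => /= i j _ _ ij; rewrite -preimage_setI.
  by move/trivIsetP : tF => /(_ _ _ _ _ ij) ->//; rewrite preimage_set0.
- by rewrite -preimage_bigcup -[X in measurable X]setTI; exact: mc.
Qed.

HB.instance Definition _ := isMeasure.Build _ _ _ lebesgue_rV_S m0 m_ge0 m_add.

Let m_sf : sigma_finite setT lebesgue_rV_S.
Proof.
have /sigma_finiteP[H [HT ndH H1]] := sigma_finiteT mu.
have /sigma_finiteP[F [FT ndF F1]] := sigma_finiteT (@lebesgue_measure R).
pose K i := F i `*` H i.
have KT : [set: measurableTypeR R * 'rV[R]_n] = \bigcup_i K i.
  apply/esym/seteqP; split => // -[a x] _.
  have : (\bigcup_i F i) a by rewrite -FT.
  have : (\bigcup_i H i) x by rewrite -HT.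
  move=> [i _ Hi] [j _ Fj]; exists (maxn i j) => //; split => /=.
    by move/subsetPset: (ndF _ _ (leq_maxr i j)); exact.
  by move/subsetPset: (ndH _ _ (leq_maxl i j)); exact.
pose g (x : 'rV[R]_n.+1) : measurableTypeR R * 'rV[R]_n :=
  (x ord0 ord0, @rsubmx R 1 1 n x).
have mg : measurable_fun setT g.
  apply: measurable_fun_pair => /=; first exact: (measurable_rV_coord ord0).
  apply: measurable_fun_rVP => i.
  rewrite (_ : _ \o _ = rV_coord (rshift 1 i : 'I_n.+1)).
    exact: measurable_rV_coord.
  by apply/funext => x; rewrite /= /rV_coord mxE.
have gK : cancel rV_cons g.
  move=> z; rewrite /g rV_cons0; case: z => a x; congr (_, _).
  exact: (row_mxKr (const_mx a)).
exists (fun i => g @^-1` K i).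
  by rewrite -preimage_bigcup -KT preimage_setT.
move=> i; have [mFi Fi] := F1 i; have [mHi Hi] := H1 i; split.
  by rewrite -[X in measurable X]setTI; apply: mg => //; exact: measurableX.
rewrite /lebesgue_rV_S /pushforward.
rewrite (_ : _ @^-1` _ = K i); last by apply/seteqP; split => z /=; rewrite gK.
rewrite product_measure1E//.
by rewrite lte_mul_pinfty// ge0_fin_numE.
Qed.

HB.instance Definition _ := Measure_isSigmaFinite.Build _ _ _ lebesgue_rV_S m_sf.

End lebesgue_rV_rec.

Fixpoint lebesgue_rV (R : realType) (n : nat) :
    {sigma_finite_measure set 'rV[R]_n -> \bar R} :=
  match n with
  | 0%N => [the {sigma_finite_measure set _ -> \bar R} of @dirac _ 'rV[R]_0 0 R]
  | n'.+1 => [the {sigma_finite_measure set _ -> \bar R} of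
              lebesgue_rV_S (lebesgue_rV R n')]
  end.

Lemma lebesgue_rV_box (R : realType) (n : nat) (a b : 'I_n -> R) :
  (forall i, a i <= b i) ->
  lebesgue_rV R n [set x | forall i, x ord0 i \in `[a i, b i]] =
  (\prod_(i < n) (b i - a i))%:E.
Proof.
elim: n a b => [|n IH] a b ab.
  rewrite big_ord0 /= diracE mem_set// => -[]//.
have ab' (i : 'I_n) : a (lift ord0 i) <= b (lift ord0 i) by [].
rewrite big_ord_recl EFinM -(IH _ _ ab') /= /lebesgue_rV_S /pushforward.
rewrite (_ : _ @^-1` _ = `[a ord0, b ord0]%classic `*`
  [set x : 'rV[R]_n | forall i, x ord0 i \in `[a (lift ord0 i), b (lift ord0 i)]]).
- rewrite product_measure1E//=.
    by rewrite lebesgue_measure_itv/= lte_fin; case: ltgtP (ab ord0) => // ->;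
      rewrite subrr.
  rewrite (_ : [set x | _] = \bigcap_(i in [set: 'I_n])
      (rV_coord i @^-1` `[a (lift ord0 i), b (lift ord0 i)]%classic)); last first.
    by apply/seteqP; split => x /= h i => [_|]; [exact: h|exact: (h i I)].
  apply: fin_bigcap_measurable => // i _.
  by rewrite -[X in measurable X]setTI; exact: measurable_rV_coord.
- apply/seteqP; split=> z /= h.
    split=> [|i] /=; first by rewrite -rV_cons0.
    by rewrite -rV_consS.
  move=> i; have [j ->|->] := unliftP ord0 i.
    by rewrite rV_consS; exact: h.2.
  by rewrite rV_cons0; exact: h.1.
Qed.

(* In finite dimension, having continuous iterated derivatives along every
   vector is the usual C^m condition. *)
Fixpoint is_Cm (R : realType) (V W : normedModType R) (m : nat) (f : V -> W)
    : Prop :=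
  continuous f /\
  if m is m'.+1 then
    forall v : V, (forall x, derivable f x v) /\ is_Cm m' (fun x => 'D_v f x)
  else True.

Definition smooth (R : realType) (V W : normedModType R) (f : V -> W) : Prop :=
  forall m, is_Cm m f.

Section stratified.
Variables (R : realType) (k : nat) (N : 'I_k -> nat).

Local Notation V := 'rV[R]_(\sum_(i < k) N i).

(* The layers are numbered from 0, so layer i has weight i.+1. *)
Definition dilation (lam : R) (x : V) : V :=
  \mxrow_(i < k) (lam ^+ i.+1 *: submxrow x i).

Definition homogeneous_dim : nat := (\sum_(i < k) i.+1 * N i)%N.

Definition lie_bracket (Y Z : V -> V) : V -> V :=
  fun x => 'D_(Y x) Z x - 'D_(Z x) Y x.

Inductive lie_generated (S : set (V -> V)) : (V -> V) -> Prop :=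
| lie_gen Y : S Y -> lie_generated S Y
| lie_lin (c : R) Y Z : lie_generated S Y -> lie_generated S Z ->
    lie_generated S (fun x => c *: Y x + Z x)
| lie_brk Y Z : lie_generated S Y -> lie_generated S Z ->
    lie_generated S (lie_bracket Y Z).

(* The left-invariant field equal to the j-th coordinate vector at 0. *)
Definition left_invariant_field (op : V -> V -> V)
    (j : 'I_(\sum_(i < k) N i)) : V -> V :=
  fun x => 'D_(delta_mx ord0 j) (op x) 0.

Definition horizontal_fields (op : V -> V -> V) : set (V -> V) :=
  [set Y | exists2 j, tagnat.sig1 j = 0%N :> nat & Y = left_invariant_field op j].

(* The neutral element is 0: it is the only point fixed by all dilations. *)
Record stratified_group := StratifiedGroup {
  sg_op : V -> V -> V;
  sg_inv : V -> V;
  sg_opA : associative sg_op;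
  sg_op0x : left_id 0 sg_op;
  sg_opVx : left_inverse 0 sg_inv sg_op;
  sg_op_smooth : smooth (fun z : V * V => sg_op z.1 z.2);
  sg_inv_smooth : smooth sg_inv;
  sg_dilation : forall lam : R, 0 < lam ->
    {morph dilation lam : x y / sg_op x y} /\ bijective (dilation lam);
  sg_hormander : forall x : V,
    exists Y : 'I_(\sum_(i < k) N i) -> V -> V,
      (forall i, lie_generated (horizontal_fields sg_op) (Y i)) /\
      \rank (\matrix_i Y i x) = (\sum_(i < k) N i)%N
}.

Definition hdist (G : stratified_group) (q : V -> R) (x y : V) : R :=
  q (sg_op G (sg_inv G y) x).

Record homogeneous_norm (G : stratified_group) := HomogeneousNorm {
  hn_fun :> V -> R;
  hn_continuous : continuous hn_fun;
  hn_ge0 : forall x, 0 <= hn_fun x;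
  hn_eq0 : forall x, hn_fun x = 0 <-> x = 0;
  hn_inv : forall x, hn_fun (sg_inv G x) = hn_fun x;
  hn_dilation : forall (lam : R) x, 0 < lam ->
    hn_fun (dilation lam x) = lam * hn_fun x;
  hn_triangle : forall x y z,
    hdist G hn_fun x z <= hdist G hn_fun x y + hdist G hn_fun y z
}.

Variables (G : stratified_group) (q : homogeneous_norm G).

Local Notation mu := (lebesgue_rV R (\sum_(i < k) N i)).
Local Notation Q := (homogeneous_dim%:R : R).
Local Notation d := (hdist G q).

Local Open Scope ereal_scope.

(* On the diagonal the quotient is 0, since 0^-1 = 0. *)
Definition gagliardo (s p : R) (U : set V) (u : V -> R) : \bar R :=
  (\int[mu]_(y in U) \int[mu]_(x in U)
     (`|u x - u y| `^ p / d x y `^ (Q + p * s))%:E) `^ p^-1.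

Definition Lp_norm (p : \bar R) (U : set V) (u : V -> R) : \bar R :=
  'N[mu]_p[EFin \o patch (fun=> 0%R) U u].

Definition Lp (p : \bar R) (U : set V) : set (V -> R) :=
  [set u | measurable_fun U u /\ Lp_norm p U u < +oo].

Definition sobolev (s p : R) (U : set V) : set (V -> R) :=
  [set u | Lp p%:E U u /\ gagliardo s p U u < +oo].

Definition test_function (Om : set V) : set (V -> R) :=
  [set phi | [/\ @smooth R V R^o phi, compact (closure [set x | phi x != 0%R])
               & closure [set x | phi x != 0%R] `<=` Om]].

Definition X0_norm (s p : R) (Om : set V) (u : V -> R) : \bar R :=
  Lp_norm p%:E Om u + gagliardo s p setT u.

(* The completion of the test functions, realized inside W^{s,p}(G).  Elements
   are representatives: functions equal a.e. are the same element. *)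
Definition X0 (s p : R) (Om : set V) : set (V -> R) :=
  [set u | [/\ sobolev s p setT u,
               {ae mu, forall x, ~ Om x -> u x = 0%R}
             & exists phi : nat -> V -> R,
                 (forall n, test_function Om (phi n)) /\
                 X0_norm s p Om (fun x => phi n x - u x)%R
                   @[n --> \oo] --> 0]].

(* The supremum is taken in [0, +oo], so that it is 0 when Om has at most one
   point. *)
Definition holder_seminorm (al : R) (Om : set V) (u : V -> R) : \bar R :=
  maxe 0 (ereal_sup [set t | exists x y, [/\ Om x, Om y, x != y &
                             t = (`|u x - u y| / d x y `^ al)%:E]]).

Definition holder_norm (al : R) (Om : set V) (u : V -> R) : \bar R :=
  Lp_norm +oo Om u + holder_seminorm al Om u.

Definition holder (al : R) (Om : set V) : set (V -> R) :=
  [set u | Lp +oo Om u /\ holder_seminorm al Om u < +oo].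

(* C^{0,al} of the closure of Om, normed by holder_norm al Om. *)
Definition holder_closure (al : R) (Om : set V) : set (V -> R) :=
  holder al Om `&` [set u | {within closure Om, continuous u}].

(* Embeddings of a space A of classes of functions modulo a.e. equality into a
   space B of functions on the open set Om: u in A is sent to its
   representative v in B, with v = u a.e. in Om. *)
Definition representative (Om : set V) (u v : V -> R) : Prop :=
  {ae mu, forall x, Om x -> v x = u x}.

Definition continuously_embedded (Om : set V)
    (A : set (V -> R)) (nA : (V -> R) -> \bar R)
    (B : set (V -> R)) (nB : (V -> R) -> \bar R) : Prop :=
  exists2 C : R, (0 < C)%R &
    forall u, A u ->
      exists v, [/\ B v, representative Om u v & nB v <= C%:E * nA u].

Definition compactly_embedded (Om : set V)
    (A : set (V -> R)) (nA : (V -> R) -> \bar R)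
    (B : set (V -> R)) (nB : (V -> R) -> \bar R) : Prop :=
  continuously_embedded Om A nA B nB /\
  forall u v : nat -> V -> R,
    (forall n, A (u n)) ->
    (exists M : R, forall n, nA (u n) <= M%:E) ->
    (forall n, B (v n) /\ representative Om (u n) (v n)) ->
    exists (sg : nat -> nat) (w : V -> R),
      [/\ {homo sg : m n / (m < n)%N}, B w
        & nB (fun x => v (sg n) x - w x)%R @[n --> \oo] --> 0].

End stratified.

(* Main.v *)
Require Import Defs.
From mathcomp Require Import all_boot all_order all_algebra.
From mathcomp Require Import all_classical all_reals all_analysis.
From mathcomp Require Import measurable_realfun ess_sup_inf ring lra.
Import Order.TTheory GRing.Theory Num.Theory.
Import numFieldNormedType.Exports.
Local Open Scope classical_set_scope.
Local Open Scope ring_scope.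

(** An element of [X0] is only measurable, while the comparison of cells at a point [x] needs a
    starting value there. So the Morrey estimates are run on continuous functions only: continuity
    makes the oscillation small on some cell of radius [r / 2 ^+ i], and the bound obtained by
    climbing back to [r] is independent of [i]. Measurable functions enter only as dominators
    ([X0_morrey]). Cells are used as averaging sets because their measure reduces to iterated
    one-dimensional integrals. The exponent comes from scaling: with energy at most g^p and points
    at distance at most D, Young's inequality at threshold g D^al makes the energy term g D^al
    D^(2Q), comparable to g D^al times the product of two cell measures at scale D. *)

(* Write w(i) for the weight of the i-th coordinate.  By homogeneity the
   derivative of the i-th coordinate of x o y in y_j is constant as soon as
   w(j) >= w(i), so left translations are triangular shears, and the cells
   x o {|e_i| <= eps r^w(i)}, contained in balls of radius r, have Lebesgue
   measure c r^Q.  For a continuous u of finite energy, comparing the mean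
   oscillations over the cells of radii r, r/2, r/4, ... gives
   |u(x) - u(y)| <= C [u] d(x,y)^al and a sup bound.  Applied to differences of
   test functions approximating an element of X_0, these estimates give a
   pointwise limit, which is a representative by Fatou's lemma.  Compactness
   follows from a pointwise cluster point (Tychonoff), equicontinuity on finite
   nets, and interpolation between the sup norm and the al-seminorm. *)

Set Implicit Arguments.
Unset Strict Implicit.
Unset Printing Implicit Defensive.

(** * Borel sets of row vectors *)

Section borel_rV.
Variables (R : realType) (n : nat).
Local Notation V := 'rV[R]_n.

Lemma measurable_rV_ball (a : V) (r : R) : measurable (ball a r).
Proof.
have [r0|r0] := ltP 0 r; last first.
  rewrite (_ : ball a r = set0); first exact: measurable0.
  by apply/seteqP; split => // x [r1 _]; move: (lt_le_trans r1 r0); rewrite ltxx.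
rewrite (_ : ball a r = \bigcap_(i in [set: 'I_n])
   (@rV_coord R n i @^-1` (ball (a ord0 i) r))); last first.
  apply/seteqP; split => x /=; first by move=> [_ h] i _; exact: h.
  by move=> h; split=> // i j; rewrite (ord1 i); exact: h.
apply: fin_bigcap_measurable => // i _.
rewrite -[X in measurable X]setTI; apply: measurable_rV_coord => //.
exact: measurable_ball.
Qed.

Definition rV_rat (t : {ffun 'I_n -> rat}) : V := \row_i ratr (t i).

Lemma rV_rat_near (x : V) (e : R) : 0 < e -> exists t, ball x e (rV_rat t).
Proof.
move=> e0.
have h i : exists y : rat, ball (x ord0 i) e (ratr y).
  have /rat_in_itvoo[y] : x ord0 i - e < x ord0 i + e by lra.
  by rewrite in_itv /= => y1; exists y; rewrite /ball /= ltr_distlC.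
have /choice[t th] : forall i : 'I_n, exists y : rat, ball (x ord0 i) e (ratr y).
  exact: h.
exists (finfun t); split=> // i j.
by rewrite (ord1 i) mxE ffunE; exact: th.
Qed.

(** The sigma-algebra is generated by coordinates, so an open set has to be exhausted by countably
    many products of rational balls. Pairs come first because the kernel lives on [V * V]; the
    one-variable case is a pullback along the diagonal. *)
Lemma open_measurable_rV2 (U : set (V * V)) : open U -> measurable U.
Proof.
move=> oU.
pose I := ({ffun 'I_n -> rat} * {ffun 'I_n -> rat} * nat)%type.
pose B (i : I) := ball (rV_rat i.1.1) i.2.+1%:R^-1 `*` ball (rV_rat i.1.2) i.2.+1%:R^-1.
(* Running over all rational balls of radius 1/(m+1), emptied unless they fit in [U], keeps the
   index type countable. *)
pose F (i : I) := if `[< B i `<=` U >] then B i else set0.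
have -> : U = \bigcup_i F i.
  apply/seteqP; split => [z Uz|z [i _]]; last first.
    by rewrite /F; case: asboolP => [BU /BU|_ []].
  have /nbhs_ballP[e /= e0 eU] : nbhs z U by move: oU; rewrite openE; exact.
  have e20 : 0 < e / 2 by rewrite divr_gt0.
  have [m _ /(_ m (leqnn _)) me] := near_infty_natSinv_lt (PosNum e20).
  rewrite /= in me.
  have m0 : 0 < m.+1%:R^-1 :> R by rewrite invr_gt0.
  have [t1 ht1] := rV_rat_near z.1 m0.
  have [t2 ht2] := rV_rat_near z.2 m0.
  exists ((t1, t2), m) => //; rewrite /F; case: asboolP => [_|]; last first.
    move=> h; exfalso; apply: h => w [/= w1 w2]; apply: eU.
    have h x y t : ball x m.+1%:R^-1 (rV_rat t) ->
       ball (rV_rat t) m.+1%:R^-1 y -> ball x e y.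
      move=> h1 h2; apply: (le_ball _ (ball_triangle h1 h2)).
      by apply: ltW; rewrite [ltRHS]splitr ltrD.
    by split; apply: h; eassumption.
  by split; apply/ball_sym.
apply: (@countable_bigcupT_measurable _ (V * V)%type I F) => [|i].
  exact: countableP.
rewrite /F; case: asboolP => _; last exact: measurable0.
by apply: measurableX; exact: measurable_rV_ball.
Qed.

Lemma continuous_measurable_rV2 (f : V * V -> R) :
  continuous f -> measurable_fun [set: V * V] f.
Proof.
move=> /continuousP cf; apply: (measurability _ (RGenOpens.measurableE R)).
move=> _ [_ [a [b ->] <-]]; rewrite setTI; apply: open_measurable_rV2.
exact/cf/interval_open.
Qed.

Lemma open_measurable_rV (U : set V) : open U -> measurable U.
Proof.
move=> oU; rewrite (_ : U = (fun x => (x, x)) @^-1` (fst @^-1` U : set (V * V)))//.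
rewrite -[X in measurable X]setTI.
apply: (measurable_fun_pair (@measurable_id _ _ _) (@measurable_id _ _ _)) => //.
apply: open_measurable_rV2; apply: open_comp => // z _; exact: cvg_fst.
Qed.

Lemma continuous_measurable_rV (f : V -> R) :
  continuous f -> measurable_fun [set: V] f.
Proof.
move=> /continuousP cf; apply: (measurability _ (RGenOpens.measurableE R)).
move=> _ [_ [a [b ->] <-]]; rewrite setTI; apply: open_measurable_rV.
exact/cf/interval_open.
Qed.

End borel_rV.

(** * Triangular structure of the group law *)

Section directional.
Variables (R : realType) (W : normedModType R).

(** Turns a directional derivative into a one-variable one, so that the chain rule and the constancy
    criterion on the real line apply. *)
Lemma is_derive_line (g : W -> R) (v z : W) (t : R) :
  derivable g (t *: v + z) v ->
  is_derive t 1 (fun u : R => g (u *: v + z)) ('D_v g (t *: v + z)).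
Proof.
move=> dg.
have E : (fun h : R => h^-1 *: (((fun u : R => g (u *: v + z)) \o shift t) (h *: 1) -
      g (t *: v + z))) =
    (fun h : R => h^-1 *: ((g \o shift (t *: v + z)) (h *: v) - g (t *: v + z))).
  apply/funext => h /=; have -> : h *: (1 : R) = h by rewrite /GRing.scale /= mulr1.
  by rewrite scalerDl addrA.
split; first by rewrite /derivable E.
by rewrite /derive E.
Qed.

(* The derivative of g along v is homogeneous of degree l - m <= 0, so, being
   continuous at 0, it is constant (and 0 if l < m). *)
Lemma homogeneous_derive_cst (g : W -> R) (delta : R -> W -> W) (v : W) (l m : nat) :
  (l <= m)%N -> (forall z, derivable g z v) -> continuous ('D_v g) ->
  (forall (lam : R) z (t : R), 0 < lam ->
    g ((lam ^+ m * t) *: v + delta lam z) = lam ^+ l * g (t *: v + z)) ->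
  (forall z, delta lam z @[lam --> (0 : R)] --> 0) ->
  forall z t, g (t *: v + z) = g z + t * (0 ^+ (m - l) * 'D_v g 0).
Proof.
move=> lm dg cg hom del0.
(* [0 ^+ (m - l)] is 1 when [l = m] and 0 when [l < m]: one formula for both cases. *)
have cst z : 'D_v g z = 0 ^+ (m - l) * 'D_v g 0.
  (* Differentiate [hom] in [t] at 0: the chain rule puts [lam ^+ m] on the left, linearity
     [lam ^+ l] on the right, and [lam ^+ l] cancels. Afterwards [lam] tends to 0 from the right. *)
  have eqn lam : 0 < lam -> lam ^+ (m - l) * 'D_v g (delta lam z) = 'D_v g z.
    move=> lam0.
    have h1 := is_derive_line (dg (0 *: v + z)).
    have h2 := is_derive_line (dg ((lam ^+ m * 0) *: v + delta lam z)).
    have h3 : is_derive (0 : R) (1 : R) (fun t => lam ^+ m * t) (lam ^+ m).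
      have := is_deriveZ (lam ^+ m) (is_derive_id (0 : R) (1 : R)).
      by rewrite /GRing.scale/= mulr1.
    have h4 := is_derive1_comp h2 h3.
    have h5 := is_deriveZ (lam ^+ l) h1.
    have E : (fun u => g (u *: v + delta lam z)) \o (fun t => lam ^+ m * t) =
       lam ^+ l *: (fun u : R => g (u *: v + z)).
      by apply/funext => t /=; rewrite hom.
    rewrite E in h4.
    have := @derive_val _ _ _ _ _ _ _ h4.
    rewrite (@derive_val _ _ _ _ _ _ _ h5) mulr0 !scale0r !add0r.
    rewrite /GRing.scale/= -[in lam ^+ m](subnK lm) exprD mulrCA.
    by move=> e; apply: (mulfI (lt0r_neq0 (exprn_gt0 l lam0))); rewrite e; ring.
  move: (cg 0) eqn; set h := 'D_v g; move=> cg0 eqn.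
  have k1 : h (delta lam z) @[lam --> (0 : R)] --> h 0.
    exact: (cvg_comp _ _ (del0 z) cg0).
  have k0 : lam ^+ (m - l) * h (delta lam z) @[lam --> (0 : R)] --> 0 ^+ (m - l) * h 0.
    by apply: cvgM => //; exact: exprn_continuous.
  have {}k0 := cvg_at_right_filter k0.
  apply: (cvg_unique _ _ k0) => //.
  apply: cvg_near_cst; near=> lam; apply: eqn; near: lam.
  exact: nbhs_right_gt.
move=> z t; rewrite -(cst 0).
have cz y : 'D_v g y = 'D_v g 0 by rewrite (cst y) -(cst 0).
move: ('D_v g 0) cz => c cz.
pose f u := g (u *: v + z) - c * u.
suff : f t = f 0.
  by rewrite /f scale0r add0r mulr0 subr0 => /eqP; rewrite subr_eq mulrC => /eqP.
apply: is_derive_0_is_cst => u.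
have h1 := is_derive_line (dg (u *: v + z)).
rewrite cz in h1.
have h3 : is_derive u (1 : R) (fun t => c * t) c.
  have := is_deriveZ c (is_derive_id u (1 : R)).
  by rewrite /GRing.scale/= mulr1.
by have := is_deriveB h1 h3; rewrite subrr.
Unshelve. all: by end_near. Qed.

End directional.

Lemma cvg_rV (R : realType) (n : nat) (T : Type) (F : set_system T) (FF : Filter F)
    (f : T -> 'rV[R]_n) (l : 'rV[R]_n) :
  (forall i, f x ord0 i @[x --> F] --> l ord0 i) -> f @ F --> l.
Proof.
move=> h; apply/cvg_ballP => e e0.
have : \forall x \near F, forall i, ball (l ord0 i) e (f x ord0 i).
  by apply: filter_forall => i; move/cvg_ballP: (h i); exact.
by apply: filterS => x hx; split=> // i j; rewrite (ord1 i).
Qed.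

Section triangular.
Variables (R : realType) (k : nat) (N : 'I_k -> nat).
Local Notation n := (\sum_(i < k) N i)%N.
Local Notation V := 'rV[R]_n.

Definition weight (j : 'I_n) : nat := (tagnat.sig1 j).+1.

Lemma dilationE (lam : R) (x : V) (j : 'I_n) :
  dilation lam x ord0 j = lam ^+ weight j * x ord0 j.
Proof.
rewrite /dilation mxE !mxE /weight; congr (_ * x _ _).
by rewrite -[in RHS](tagnat.sig2K j).
Qed.

Lemma dilationD (lam : R) : {morph @dilation R k N lam : x y / x + y}.
Proof.
by move=> x y; apply/rowP => j; rewrite dilationE mxE [RHS]mxE !dilationE mulrDr.
Qed.

Lemma dilation_delta (lam t : R) (j : 'I_n) :
  @dilation R k N lam (t *: delta_mx ord0 j) = (lam ^+ weight j * t) *: delta_mx ord0 j.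
Proof.
apply/rowP => i; rewrite dilationE !mxE eqxx /= mulrA.
by have [->//|_] := eqVneq i j; rewrite !mulr0.
Qed.

Lemma cvg_dilation0 (x : V) : dilation lam x @[lam --> (0 : R)] --> (0 : V).
Proof.
apply: cvg_rV => j.
under eq_fun do rewrite dilationE.
have : lam ^+ weight j * x ord0 j @[lam --> (0 : R)] --> 0 ^+ weight j * x ord0 j.
  by apply: cvgMl; exact: exprn_continuous.
by rewrite expr0n /= mul0r mxE.
Qed.

Lemma sg_opKV (G : stratified_group R N) (y : V) :
  cancel (sg_op G y) (sg_op G (sg_inv G y)).
Proof. by move=> z; rewrite sg_opA sg_opVx sg_op0x. Qed.

Lemma sg_opxV (G : stratified_group R N) (x : V) : sg_op G x (sg_inv G x) = 0.
Proof.
by rewrite -[LHS](sg_opKV G (sg_inv G x)) (sg_opA G (sg_inv G x)) sg_opVx sg_op0x sg_opVx.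
Qed.

Lemma sg_opx0 (G : stratified_group R N) (x : V) : sg_op G x 0 = x.
Proof. by rewrite -(sg_opVx G x) sg_opA sg_opxV sg_op0x. Qed.

Lemma sg_invK (G : stratified_group R N) : involutive (sg_inv G).
Proof.
move=> x; rewrite -[RHS](sg_op0x G) -(sg_opVx G (sg_inv G x)) -sg_opA sg_opVx.
by rewrite sg_opx0.
Qed.

Lemma sg_invM (G : stratified_group R N) (x y : V) :
  sg_inv G (sg_op G x y) = sg_op G (sg_inv G y) (sg_inv G x).
Proof.
apply: (can_inj (sg_opKV G (sg_op G x y))).
by rewrite sg_opxV -sg_opA (sg_opA G y) sg_opxV sg_op0x sg_opxV.
Qed.

(** Apply [homogeneous_derive_cst] on [V * V] to the i-th coordinate of the product, along
    [(0, e_j)]: the product is jointly smooth and commutes with dilating both factors. The slope is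
    then the same at every point, and is read off at the origin, where left translation is the
    identity. *)
Lemma sg_op_triangular (G : stratified_group R N) (a x : V) (i j : 'I_n) (t : R) :
  (weight i <= weight j)%N ->
  sg_op G a (x + t *: delta_mx ord0 j) ord0 i = sg_op G a x ord0 i + t * (i == j)%:R.
Proof.
move=> ij.
pose g (z : V * V) : R := sg_op G z.1 z.2 ord0 i.
pose delta (lam : R) (z : V * V) : V * V := (dilation lam z.1, dilation lam z.2).
pose v : V * V := (0, delta_mx ord0 j).
have [_ /(_ v)[df [cf _]]] := sg_op_smooth G 1.
have dg z : derivable g z v by move/derivable_mxP: (df z); exact.
have cg : continuous ('D_v g).
  move=> z.
  rewrite (_ : 'D_v g = fun z => 'D_v (fun z : V * V => sg_op G z.1 z.2) z ord0 i).
    exact: (cvg_comp _ _ (cf z) (@coord_continuous R 1 n ord0 i _)).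
  by apply/funext => y; rewrite derive_mx// mxE.
have hom (lam : R) (z : V * V) (u : R) : 0 < lam ->
    g ((lam ^+ weight j * u) *: v + delta lam z) = lam ^+ weight i * g (u *: v + z).
  move=> lam0; rewrite /g -dilationE.
  have [-> _] := sg_dilation G lam0.
  by rewrite /= !scaler0 !add0r dilationD dilation_delta.
have del0 (z : V * V) : delta lam z @[lam --> (0 : R)] --> (0 : V * V).
  exact: (cvg_pair (cvg_dilation0 z.1) (cvg_dilation0 z.2)).
have key := homogeneous_derive_cst ij dg cg hom del0.
have e0 (u : R) : g (u *: v + 0) = u * (i == j)%:R.
  by rewrite /g /= addr0 scaler0 sg_op0x !mxE eqxx /= addr0.
have := key 0 1; rewrite e0 !mul1r -[g 0]/(g (0, 0)) => e1.
have g0 : g (0, 0) = 0 by rewrite /g /= sg_op0x mxE.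
have := key (a, x) t.
rewrite /g /= scaler0 add0r addrC => ->; congr (_ + t * _).
by rewrite e1 g0 add0r.
Qed.

End triangular.

(** * Lebesgue measure of sheared boxes *)

Section sheared_box.
Variable R : realType.

Lemma invariant_rV_cst (n : nat) (F : 'rV[R]_n -> R) :
  (forall j x t, F (x + t *: delta_mx ord0 j) = F x) -> forall x, F x = F 0.
Proof.
move=> inv x; rewrite [x in LHS](row_sum_delta x).
elim: (index_enum _) => [|j s IH]; first by rewrite big_nil.
by rewrite big_cons addrC inv.
Qed.

Lemma rV_cons_addE (n : nat) (z0 t : R) (x : 'rV[R]_n) (j : 'I_n) :
  rV_cons (z0, x + t *: delta_mx ord0 j) =
  rV_cons (z0, x) + t *: delta_mx ord0 (lift ord0 j).
Proof.
apply/rowP => i; rewrite [RHS]mxE; have [i' ->|->] := unliftP ord0 i.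
  by rewrite !rV_consS !mxE !eqxx (inj_eq lift_inj).
by rewrite !rV_cons0 !mxE eqxx (negbTE (neq_lift _ _)) mulr0 addr0.
Qed.

Lemma measurable_sheared_box (n : nat) (F : 'I_n -> 'rV[R]_n -> R) (a : 'I_n -> R) :
  (forall i, measurable_fun setT (F i)) ->
  measurable [set x : 'rV[R]_n | forall i, `|x ord0 i + F i x| <= a i].
Proof.
move=> mF.
rewrite (_ : [set x | _] = \bigcap_(i in [set: 'I_n])
  ((fun x : 'rV[R]_n => `|x ord0 i + F i x|) @^-1` `]-oo, a i]%classic)); last first.
  apply/seteqP; split => x /= h i; first by move=> _ /=; rewrite in_itv /=.
  by have := h i I; rewrite /= in_itv.
apply: fin_bigcap_measurable => // i _.
rewrite -[X in measurable X]setTI.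
have : measurable_fun setT (fun x : 'rV[R]_n => `|x ord0 i + F i x|).
  apply: measurableT_comp => //; apply: measurable_funD => //.
  exact: measurable_rV_coord.
by apply.
Qed.

(* A triangular shear preserves Lebesgue measure: integrate the last coordinates
   first. *)
Lemma lebesgue_sheared_box (n : nat) (F : 'I_n -> 'rV[R]_n -> R) (a : 'I_n -> R) :
  (forall i, measurable_fun setT (F i)) ->
  (forall (i j : 'I_n) x t, (i <= j)%N -> F i (x + t *: delta_mx ord0 j) = F i x) ->
  (forall i, 0 <= a i) ->
  lebesgue_rV R n [set x : 'rV[R]_n | forall i, `|x ord0 i + F i x| <= a i] =
    (\prod_(i < n) (2 * a i))%:E.
Proof.
elim: n F a => [|n IH] F a mF tri a0.
  by rewrite big_ord0 /= diracE mem_set// => -[].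
rewrite big_ord_recl EFinM /= /lebesgue_rV_S /pushforward.
set A := _ @^-1` _.
pose c := F ord0 0.
(* Every [j] satisfies [ord0 <= j], so by [tri] the first shear is blind to all coordinates. *)
have F0 x : F ord0 x = c by apply: invariant_rV_cst => j y t; apply: tri.
pose F' (z0 : R) (i : 'I_n) (x : 'rV[R]_n) := F (lift ord0 i) (rV_cons (z0, x)).
have mF' z0 i : measurable_fun setT (F' z0 i).
  apply: (measurableT_comp (mF _)); apply: (measurableT_comp (@measurable_rV_cons R n)).
  exact: (measurable_fun_pair (measurable_cst _) (@measurable_id _ _ _)).
have tri' z0 (i j : 'I_n) x t : (i <= j)%N -> F' z0 i (x + t *: delta_mx ord0 j) = F' z0 i x.
  by move=> ij; rewrite /F' rV_cons_addE tri.
have IH' z0 := IH (F' z0) (fun i => a (lift ord0 i)) (mF' z0) (tri' z0) (fun i => a0 _).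
set K := \prod_(i < n) _ in IH' *.
(* Over an admissible first coordinate [z0] the section is a sheared box in dimension [n], of
   measure [K] whatever [z0]; the admissible interval is merely shifted by [- c]. *)
have secE z0 : lebesgue_rV R n (xsection A z0) =
    if z0 \in `[- c - a ord0, - c + a ord0] then K%:E else 0%E.
  rewrite in_itv /=; case: ifPn => h.
    rewrite -(IH' z0); congr (lebesgue_rV R n _); apply/seteqP; split => x.
      rewrite /xsection /= inE /= => + i => /(_ (lift ord0 i)).
      by rewrite rV_consS.
    move=> hx; rewrite /xsection /= inE /= => i.
    have [j ->|->] := unliftP ord0 i; first by rewrite rV_consS; exact: hx.
    by rewrite F0 rV_cons0 /= ler_norml; lra.
  rewrite (_ : xsection _ _ = set0) ?measure0//.
  apply/seteqP; split => // x; rewrite /xsection /= inE /= => /(_ ord0).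
  by rewrite F0 rV_cons0 /= ler_norml => h'; move/negP: h; apply; lra.
rewrite /product_measure1 /=.
under eq_integral do rewrite /= secE.
transitivity (\int[@lebesgue_measure R]_(x in `[(- c - a ord0)%R, (- c + a ord0)%R]) K%:E)%E.
  rewrite [RHS]integral_mkcond; apply: eq_integral => x _.
  by rewrite patchE; congr (if _ then _ else _); apply/idP/idP; rewrite inE.
rewrite integral_cst//= lebesgue_measure_itv /= lte_fin.
have := a0 ord0; rewrite le_eqVlt => /predU1P[<-|h].
  by rewrite subr0 addr0 ltxx mulr0 mul0e mule0.
rewrite ifT; last by lra.
rewrite -EFinB -!EFinM; congr (_%:E); ring.
Qed.

End sheared_box.

(** * Cells *)

Section cells.
Variables (R : realType) (k : nat) (N : 'I_k -> nat).
Local Notation n := (\sum_(i < k) N i)%N.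
Local Notation V := 'rV[R]_n.
Local Notation mu := (lebesgue_rV R n).

(** [tagnat] numbers the coordinates layer by layer, so triangularity in the weights becomes the
    triangularity in the indices that [lebesgue_sheared_box] asks for. *)
Lemma weight_mono (i j : 'I_n) : (i <= j)%N -> (weight i <= weight j)%N.
Proof.
move=> ij; rewrite /weight ltnS; have := @tagnat.le_sig1 k N i j.
by rewrite !leEord; apply.
Qed.

Lemma sum_weight : (\sum_(j < n) weight j = homogeneous_dim N)%N.
Proof.
rewrite /homogeneous_dim (reindex _ (@tagnat.rank_bij_on k N)) /=.
transitivity (\sum_(p : {i & 'I_(N i)}) (tag p).+1)%N.
  by apply: eq_bigr => p _; rewrite /weight /tagnat.sig1 tagnat.rankK.
have := @sig_big_dep _ 0%N addn 'I_k (fun i => 'I_(N i)) xpredT (fun _ => xpredT)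
  (fun i _ => i.+1).
move=> /= <-.
by apply: eq_bigr => i _; rewrite sum_nat_const card_ord mulnC.
Qed.

Variables (G : stratified_group R N) (q : homogeneous_norm G).
Local Notation d := (hdist G q).

Lemma hdistC (x y : V) : d x y = d y x.
Proof. by rewrite /hdist -(hn_inv q) sg_invM sg_invK. Qed.

Lemma hdistxx (x : V) : d x x = 0.
Proof. by rewrite /hdist sg_opVx; apply/hn_eq0. Qed.

Lemma hdist_ge0 (x y : V) : 0 <= d x y. Proof. exact: hn_ge0. Qed.

Lemma hdist_eq0 (x y : V) : d x y = 0 -> x = y.
Proof.
move=> /hn_eq0 e; apply/esym; rewrite -[RHS](sg_opKV G (sg_inv G y)) e sg_opx0.
by rewrite sg_invK.
Qed.

Lemma sg_op_continuous (a : V) : continuous (sg_op G a).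
Proof.
have [c _] := sg_op_smooth G 0; move=> x.
exact: (cvg_comp _ _ (cvg_pair (cvg_cst a) cvg_id) (c (a, x))).
Qed.

Lemma hdist_continuous : continuous (fun z : V * V => d z.1 z.2).
Proof.
have [c _] := sg_op_smooth G 0; have [c' _] := sg_inv_smooth G 0; move=> z.
have p1 : (fst w : V) @[w --> z] --> z.1 by exact: cvg_fst.
have p2 : (snd w : V) @[w --> z] --> z.2 by exact: cvg_snd.
have c0 := cvg_comp _ _ p2 (c' z.2).
have c1 : (sg_inv G w.2, w.1) @[w --> z] --> (sg_inv G z.2, z.1).
  exact: (cvg_pair c0 p1).
have c2 := cvg_comp _ _ c1 (c _).
exact: (cvg_comp _ _ c2 (@hn_continuous _ _ _ _ q (sg_op G (sg_inv G z.2) z.1))).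
Qed.

Lemma hdist_cvg0 (x : V) : d y x @[y --> x] --> (0 : R).
Proof.
have c1 : (y, x) @[y --> x] --> ((x, x) : V * V).
  apply: (@cvg_pair _ _ _ (nbhs x) (nbhs x) (nbhs x) _ _ _ id (cst x)); first exact: cvg_id.
  exact: cvg_cst.
by have := cvg_comp _ _ c1 (@hdist_continuous (x, x)); rewrite /= hdistxx.
Qed.

Definition cell (eps : R) (x : V) (r : R) : set V :=
  [set z | forall i, `|sg_op G (sg_inv G x) z ord0 i| <= eps * r ^+ weight i].

(** Dilation reduces to radius 1: the rescaled point lies in a cube around 0 on which continuity
    gives [q < 1]. Halving [e] fits the closed cube into the open ball. *)
Lemma cell_hdist : exists2 eps : R, 0 < eps &
  forall x r z, 0 < r -> cell eps x r z -> d z x <= r.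
Proof.
have /cvgrPdist_lt/(_ 1 ltr01)/nbhs_ballP[e /= e0 he] := @hn_continuous _ _ _ _ q (0 : V).
have q0 : q 0 = 0 by apply/hn_eq0.
exists (e / 2); first by rewrite divr_gt0.
move=> x r z r0 h; rewrite /hdist; set y := sg_op _ _ _ in h *.
have -> : y = dilation r (dilation r^-1 y).
  by apply/rowP => j; rewrite !dilationE mulrA -exprMn divff ?gt_eqF// expr1n mul1r.
rewrite hn_dilation// ler_piMr ?ltW//.
have := he (dilation r^-1 y); rewrite q0 sub0r normrN ger0_norm ?hn_ge0//.
apply; split=> // i j; rewrite (ord1 i) /ball /= mxE sub0r normrN dilationE normrM.
rewrite ger0_norm ?exprn_ge0 ?invr_ge0 ?ltW// exprVn.
rewrite mulrC ltr_pdivrMr ?exprn_gt0//; apply: le_lt_trans (h j) _.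
by rewrite ltr_pM2r ?exprn_gt0//; lra.
Qed.

Lemma cell_sheared eps x r : cell eps x r =
  [set z : V | forall i, `|z ord0 i + (sg_op G (sg_inv G x) z ord0 i - z ord0 i)|
     <= eps * r ^+ weight i].
Proof. by apply/seteqP; split => z h i; have := h i; rewrite /cell /= addrC subrK. Qed.

Lemma measurable_shear (a : V) (i : 'I_n) :
  measurable_fun setT (fun z : V => sg_op G a z ord0 i - z ord0 i).
Proof.
apply: measurable_funB; last exact: measurable_rV_coord.
apply: continuous_measurable_rV => x.
exact: (cvg_comp _ _ (@sg_op_continuous a x) (@coord_continuous R 1 n ord0 i _)).
Qed.

Lemma measurable_cell eps x r : measurable (cell eps x r).
Proof.
rewrite cell_sheared.
exact: (measurable_sheared_box _ (fun i => measurable_shear _ i)).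
Qed.

Lemma mu_cell eps x r : 0 <= eps -> 0 <= r ->
  mu (cell eps x r) = ((2 * eps) ^+ n * r ^+ homogeneous_dim N)%:E.
Proof.
move=> eps0 r0; rewrite cell_sheared.
rewrite (lebesgue_sheared_box (fun i => measurable_shear _ i)).
- congr (_%:E); under eq_bigr do rewrite mulrA.
  by rewrite big_split /= prodr_const card_ord -sum_weight -expr_sum.
(* The increment [t * (i == j)] of the product is exactly that of [z ord0 i], so their difference
   does not move. *)
- move=> i j z t ij; rewrite sg_op_triangular ?weight_mono// !mxE eqxx /=.
  ring.
- by move=> i; rewrite mulr_ge0 ?exprn_ge0.
Qed.

End cells.

(** * Integrals of nonnegative functions *)

Section nonneg_integrals.
Context d (T : measurableType d) (R : realType) (P : {measure set T -> \bar R}).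
Implicit Types (D : set T) (f g : T -> R).
Local Open Scope ereal_scope.

Lemma ge0_integral_le D f g : measurable D ->
  measurable_fun setT f -> measurable_fun setT g ->
  (forall x, D x -> (0 <= f x <= g x)%R) ->
  \int[P]_(x in D) (f x)%:E <= \int[P]_(x in D) (g x)%:E.
Proof.
move=> mD mf mg fg; apply: ge0_le_integral => //.
- by move=> x /fg /andP[]; rewrite lee_fin.
- by apply/measurable_EFinP; exact: measurable_funTS.
- by apply/measurable_EFinP; exact: measurable_funTS.
- by move=> x /fg /andP[]; rewrite lee_fin.
Qed.

Lemma ge0_integral_addE D f g : measurable D ->
  measurable_fun setT f -> measurable_fun setT g ->
  (forall x, (0 <= f x)%R) -> (forall x, (0 <= g x)%R) ->
  \int[P]_(x in D) (f x + g x)%:E = \int[P]_(x in D) (f x)%:E + \int[P]_(x in D) (g x)%:E.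
Proof.
move=> mD mf mg f0 g0; under eq_integral do rewrite EFinD.
apply: ge0_integralD => //.
- by move=> x _; rewrite lee_fin.
- by apply/measurable_EFinP; exact: measurable_funTS.
- by move=> x _; rewrite lee_fin.
- by apply/measurable_EFinP; exact: measurable_funTS.
Qed.

Lemma ge0_integral_scaleE D f c : measurable D -> measurable_fun setT f ->
  (forall x, (0 <= f x)%R) -> (0 <= c)%R ->
  \int[P]_(x in D) (c * f x)%:E = c%:E * \int[P]_(x in D) (f x)%:E.
Proof.
move=> mD mf f0 c0; under eq_integral do rewrite EFinM.
apply: ge0_integralZl_EFin => //.
- by move=> x _; rewrite lee_fin.
- by apply/measurable_EFinP; exact: measurable_funTS.
Qed.

(** For t > delta, write t = t^(1-p) t^p; as 1 - p <= 0, the first factor is at most delta^(1-p). *)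
Lemma powR_Young (p delta t : R) : (1 <= p)%R -> (0 < delta)%R -> (0 <= t)%R ->
  (t <= delta + delta `^ (1 - p) * t `^ p)%R.
Proof.
move=> p1 d0 t0; have [td|dt] := leP t delta.
  by rewrite (le_trans td)// lerDl mulr_ge0 ?powR_ge0.
have {}t0 : (0 < t)%R by exact: lt_trans dt.
have e : t = (t `^ (1 - p) * t `^ p)%R.
  by rewrite -powRD ?subrK ?powRr1 ?ltW// gt_eqF ?implybT.
rewrite {1}e -[leLHS]add0r lerD ?(ltW d0)// ler_wpM2r ?powR_ge0//.
rewrite -[(1 - p)%R]opprB !powRN lef_pV2 ?posrE ?powR_gt0//.
by apply: ge0_ler_powR; rewrite ?nnegrE ?subr_ge0//; exact: ltW.
Qed.

(* Jensen's inequality without convexity: a <= delta + delta^(1-p) a^p. *)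
Lemma integral_Young D f (p delta m K : R) : (1 <= p)%R -> (0 < delta)%R ->
  measurable D -> measurable_fun setT f -> (forall x, (0 <= f x)%R) ->
  P D = m%:E -> \int[P]_(x in D) (f x `^ p)%:E <= K%:E ->
  \int[P]_(x in D) (f x)%:E <= (delta * m + delta `^ (1 - p) * K)%:E.
Proof.
move=> p1 d0 mD mf f0 PD fK.
have mfp : measurable_fun setT (fun x => f x `^ p)%R.
  exact: (measurableT_comp (measurable_powR p) mf).
apply: (@le_trans _ _ (\int[P]_(x in D) (delta + delta `^ (1 - p) * f x `^ p)%:E)).
  apply: ge0_integral_le => //.
    by apply: measurable_funD => //; apply: measurable_funM.
  by move=> x _; rewrite f0 powR_Young.
rewrite ge0_integral_addE//; last 3 first.
- by apply: measurable_funM.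
- by move=> x; exact: ltW.
- by move=> x; rewrite mulr_ge0 ?powR_ge0.
rewrite ge0_integral_scaleE// ?powR_ge0//; last by move=> x; exact: powR_ge0.
rewrite (integral_cst P mD delta%:E) PD EFinD !EFinM leeD//.
by rewrite lee_wpmul2l// lee_fin powR_ge0.
Qed.

End nonneg_integrals.

Section product_integrals.
Context d1 d2 (T1 : measurableType d1) (T2 : measurableType d2) (R : realType).
Variables (m1 : {sigma_finite_measure set T1 -> \bar R})
  (m2 : {sigma_finite_measure set T2 -> \bar R}).
Local Open Scope ereal_scope.

Lemma integral_setX_fst (A : set T1) (B : set T2) (f : T1 -> R) :
  measurable A -> measurable B -> measurable_fun setT f -> (forall x, (0 <= f x)%R) ->
  \int[m1 \x m2]_(z in A `*` B) (f z.1)%:E = \int[m1]_(x in A) (f x)%:E * m2 B.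
Proof.
move=> mA mB mf f0; rewrite integral_mkcond fubini_tonelli1; last 2 first.
- apply/(measurable_restrictT _ _).1; first exact: measurableX.
  apply/measurable_EFinP/measurable_funTS; exact: measurableT_comp.
- by move=> z; apply: erestrict_ge0 => ? _; rewrite lee_fin.
rewrite -ge0_integralZr//; last 2 first.
- by apply/measurable_EFinP/measurable_funTS.
- by move=> x _; rewrite lee_fin.
rewrite [RHS]integral_mkcond; apply: eq_integral => x _.
rewrite /fubini_F patchE; case: ifPn => xA.
  rewrite -(integral_cst m2 mB (f x)%:E) [RHS]integral_mkcond; apply: eq_integral => y _.
  by rewrite !patchE /= in_setX /= xA.
by rewrite integral0_eq// => y _; rewrite patchE /= in_setX /= (negbTE xA).
Qed.

Lemma integral_setX_snd (A : set T1) (B : set T2) (f : T2 -> R) :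
  measurable A -> measurable B -> measurable_fun setT f -> (forall x, (0 <= f x)%R) ->
  \int[m1 \x m2]_(z in A `*` B) (f z.2)%:E = m1 A * \int[m2]_(x in B) (f x)%:E.
Proof.
move=> mA mB mf f0; rewrite integral_mkcond fubini_tonelli2; last 2 first.
- apply/(measurable_restrictT _ _).1; first exact: measurableX.
  apply/measurable_EFinP/measurable_funTS; exact: measurableT_comp.
- by move=> z; apply: erestrict_ge0 => ? _; rewrite lee_fin.
rewrite muleC -ge0_integralZr//; last 2 first.
- by apply/measurable_EFinP/measurable_funTS.
- by move=> x _; rewrite lee_fin.
rewrite [RHS]integral_mkcond; apply: eq_integral => x _.
rewrite /fubini_G patchE; case: ifPn => xA.
  rewrite -(integral_cst m1 mA (f x)%:E) [RHS]integral_mkcond; apply: eq_integral => y _.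
  by rewrite !patchE /= in_setX /= xA andbT.
by rewrite integral0_eq// => y _; rewrite patchE /= in_setX /= (negbTE xA) andbF.
Qed.

End product_integrals.

(** * Gagliardo energy and the Morrey estimates *)

Section gagliardo_kernel.
Variables (R : realType) (k : nat) (N : 'I_k -> nat).
Local Notation n := (\sum_(i < k) N i)%N.
Local Notation V := 'rV[R]_n.
Local Notation mu := (lebesgue_rV R n).
Local Notation Q := ((homogeneous_dim N)%:R : R).
Variables (G : stratified_group R N) (q : homogeneous_norm G) (s p : R).
Local Notation d := (hdist G q).
Hypothesis p1 : 1 <= p.

Definition gagliardo_kernel (u : V -> R) (z : V * V) : R :=
  `|u z.1 - u z.2| `^ p / d z.1 z.2 `^ (Q + p * s).

Definition gagliardo_energy (u : V -> R) : \bar R :=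
  (\int[mu \x mu]_z (gagliardo_kernel u z)%:E)%E.

Lemma gagliardo_kernel_ge0 u z : 0 <= gagliardo_kernel u z.
Proof. by rewrite divr_ge0 ?powR_ge0. Qed.

Lemma measurable_diff (u : V -> R) : measurable_fun setT u ->
  measurable_fun setT (fun z : V * V => `|u z.1 - u z.2|).
Proof.
move=> um; apply: measurableT_comp => //; apply: measurable_funB.
  exact: measurableT_comp um measurable_fst.
exact: measurableT_comp um measurable_snd.
Qed.

Lemma measurable_weight : measurable_fun setT (fun z : V * V => (d z.1 z.2 `^ (Q + p * s))^-1).
Proof.
rewrite (_ : (fun _ => _) = (fun z : V * V => d z.1 z.2 `^ (- (Q + p * s)))).
  apply: (measurableT_comp (measurable_powR _)).
  exact: continuous_measurable_rV2 (@hdist_continuous _ _ _ G q).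
by apply/funext => z; rewrite powRN.
Qed.

Lemma measurable_kernel (u : V -> R) : measurable_fun setT u ->
  measurable_fun setT (gagliardo_kernel u).
Proof.
move=> um; apply: measurable_funM; last exact: measurable_weight.
exact: measurableT_comp (measurable_powR p) (measurable_diff um).
Qed.

Lemma gagliardoE (u : V -> R) : measurable_fun setT u ->
  gagliardo q s p setT u = (gagliardo_energy u `^ p^-1)%E.
Proof.
move=> um; rewrite /gagliardo /gagliardo_energy fubini_tonelli2//.
- by apply/measurable_EFinP; exact: measurable_kernel.
- by move=> z; rewrite lee_fin gagliardo_kernel_ge0.
Qed.

Lemma gagliardo_energy_le (u : V -> R) (g : R) : measurable_fun setT u -> 0 <= g ->
  (gagliardo q s p setT u <= g%:E)%E -> (gagliardo_energy u <= (g `^ p)%:E)%E.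
Proof.
move=> um g0; rewrite gagliardoE//.
have : (0 <= gagliardo_energy u)%E.
  by apply: integral_ge0 => z _; rewrite lee_fin gagliardo_kernel_ge0.
have p0 : 0 < p by exact: lt_le_trans p1.
move=> J0 Jg; rewrite -(poweRe1 J0) -(mulVf (lt0r_neq0 p0)) poweRrM -poweR_EFin.
apply: gt0_ler_poweR => //; first exact: ltW.
- by rewrite in_itv /= poweR_ge0 leey.
- by rewrite in_itv /= lee_fin g0 leey.
Qed.

Hypothesis Qps : Q < p * s.
Local Notation al := ((s * p - Q) / p).

Lemma kernel_bound (u : V -> R) (z : V * V) (D : R) : d z.1 z.2 <= D ->
  `|u z.1 - u z.2| `^ p <= D `^ (Q + p * s) * gagliardo_kernel u z.
Proof.
move=> dD; have e0 : 0 < Q + p * s by rewrite ltr_wpDl// (le_lt_trans _ Qps).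
(* On the diagonal the kernel carries no information, but there the left side is 0^p = 0. *)
have [d0|d0] := eqVneq (d z.1 z.2) 0.
  rewrite (hdist_eq0 d0) subrr normr0 powR0 ?gt_eqF ?(lt_le_trans ltr01)//.
  by rewrite mulr_ge0 ?powR_ge0 ?gagliardo_kernel_ge0.
have {}d0 : 0 < d z.1 z.2 by rewrite lt_neqAle eq_sym d0 hdist_ge0.
rewrite /gagliardo_kernel mulrCA ler_peMr ?powR_ge0//.
rewrite ler_pdivlMr ?powR_gt0// mul1r.
apply: ge0_ler_powR; rewrite ?nnegrE //; try exact: ltW.
exact: le_trans (ltW d0) dD.
Qed.

(** Young's inequality at threshold g D^al. Since al (1 - p) + Q + p s = al + 2 Q, the energy term
    becomes g D^al D^(2Q), which scales like the measure term as soon as [A] and [B] have measure of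
    order D^Q. *)
Lemma pair_integral_bound (u : V -> R) (A B : set V) (m1 m2 D g : R) :
  measurable_fun setT u -> measurable A -> measurable B ->
  mu A = m1%:E -> mu B = m2%:E -> 0 < D -> 0 < g ->
  (forall x y, A x -> B y -> d x y <= D) ->
  (gagliardo_energy u <= (g `^ p)%:E)%E ->
  (\int[mu \x mu]_(z in A `*` B) `|u z.1 - u z.2|%:E <=
    (g * D `^ al * (m1 * m2 + D ^+ (2 * homogeneous_dim N)))%:E)%E.
Proof.
move=> um mA mB muA muB D0 g0 dD Jg.
have p0 : 0 < p by exact: lt_le_trans p1.
have mAB : measurable (A `*` B) by exact: measurableX.
have PAB : (mu \x mu)%E (A `*` B) = (m1 * m2)%:E.
  by rewrite product_measure1E// EFinM -muA -muB.
have mk := measurable_kernel um.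
have md := measurable_diff um.
pose K := D `^ (Q + p * s) * g `^ p.
have hK : (\int[mu \x mu]_(z in A `*` B) (`|u z.1 - u z.2| `^ p)%:E <= K%:E)%E.
  apply: (@le_trans _ _ (\int[mu \x mu]_(z in A `*` B)
     (D `^ (Q + p * s) * gagliardo_kernel u z)%:E)%E).
    apply: ge0_integral_le => //.
    - exact: measurableT_comp (measurable_powR p) md.
    - exact: measurable_funM.
    - by move=> z [Az Bz]; rewrite powR_ge0 /= kernel_bound//; exact: dD.
  rewrite ge0_integral_scaleE ?powR_ge0//; last exact: gagliardo_kernel_ge0.
  rewrite EFinM lee_wpmul2l ?lee_fin ?powR_ge0//.
  apply: le_trans Jg; apply: ge0_subset_integral => //.
  - exact/measurable_EFinP.
  - by move=> z _; rewrite lee_fin gagliardo_kernel_ge0.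
have d0 : 0 < g * D `^ al by rewrite mulr_gt0 ?powR_gt0.
apply: (le_trans (integral_Young p1 d0 mAB md _ PAB hK)) => //.
rewrite lee_fin mulrDr lerD//.
rewrite powRM ?powR_ge0 ?(ltW g0)// -powRrM /K.
rewrite (_ : g `^ (1 - p) * D `^ (al * (1 - p)) * (D `^ (Q + p * s) * g `^ p) =
   (g `^ (1 - p) * g `^ p) * (D `^ (al * (1 - p)) * D `^ (Q + p * s))); last by ring.
have pD (x a b : R) : 0 < x -> x `^ a * x `^ b = x `^ (a + b).
  by move=> x0; rewrite powRD// (gt_eqF x0) implybT.
rewrite (pD _ _ _ g0) subrK (powRr1 (ltW g0)) (pD _ _ _ D0).
rewrite (_ : al * (1 - p) + (Q + p * s) = al + (2 * homogeneous_dim N)%:R); last first.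
  by rewrite natrM; field; rewrite gt_eqF.
by rewrite -(pD _ _ _ D0) (powR_mulrn _ (ltW D0)) mulrA lexx.
Qed.

End gagliardo_kernel.

(** * Morrey estimates for continuous functions *)

Section morrey.
Variables (R : realType) (k : nat) (N : 'I_k -> nat).
Local Notation n := (\sum_(i < k) N i)%N.
Local Notation V := 'rV[R]_n.
Local Notation mu := (lebesgue_rV R n).
Local Notation hd := (homogeneous_dim N).
Local Notation Q := (hd%:R : R).
Variables (G : stratified_group R N) (q : homogeneous_norm G) (s p : R).
Local Notation d := (hdist G q).
Local Notation al := ((s * p - Q) / p).
Hypothesis p1 : 1 <= p.
Hypothesis Qps : Q < p * s.
Variable eps : R.
Hypothesis eps0 : 0 < eps.
Hypothesis cell_d : forall x r z, 0 < r -> cell G eps x r z -> d z x <= r.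
Local Notation m r := ((2 * eps) ^+ n * r ^+ hd).

Lemma cell_nbhs (x : V) (U : set V) : nbhs x U ->
  exists2 r0 : R, 0 < r0 & forall r, 0 < r -> r < r0 -> cell G eps x r `<=` U.
Proof.
have c : sg_op G x y @[y --> (0 : V)] --> x.
  by rewrite -[X in _ --> X](sg_opx0 G); exact: sg_op_continuous.
(* Below radius 1, r^w <= r for every weight w >= 1, so [r < e / eps] controls all coordinates at
   once. *)
move=> /c/nbhs_ballP[e /= e0 he]; exists (Num.min 1 (e / eps)).
  by rewrite lt_min ltr01 divr_gt0.
move=> r r0; rewrite lt_min => /andP[r1 re] z hz.
have := he (sg_op G (sg_inv G x) z); rewrite /= sg_opA sg_opxV sg_op0x; apply.
split=> // i j; rewrite (ord1 i) /ball /= mxE sub0r normrN.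
apply: le_lt_trans (hz j) _; rewrite mulrC -ltr_pdivlMr//; apply: le_lt_trans re.
by rewrite /weight exprS ler_piMr ?exprn_ile1// ltW.
Qed.

Lemma al_gt0 : 0 < al.
Proof. by rewrite divr_gt0 ?subr_gt0 1?mulrC// (lt_le_trans ltr01). Qed.

(** Points of two cells of radius at most [r], with centres at distance at most [r], are at distance
    at most [D = 3 * r]: hence the powers of 3. The factor [2 ^+ hd] compares r^Q with rho^Q for rho
    >= r / 2, and the denominator is the product of the two cell constants. *)
Definition pair_const : R :=
  3 `^ al * (1 + 3 ^+ (2 * hd) * 2 ^+ hd / ((2 * eps) ^+ n * (2 * eps) ^+ n)).

(* The sum of the geometric series pair_const * (1/2)^(al * i). *)
Definition osc_const : R := pair_const / (1 - 2 `^ (- al)).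

Let m_gt0 r : 0 < r -> 0 < m r.
Proof. by move=> r0; rewrite mulr_gt0 ?exprn_gt0 ?mulr_gt0. Qed.

Lemma pair_const_gt0 : 0 < pair_const.
Proof.
have e2 : 0 < (2 * eps) ^+ n by rewrite exprn_gt0 ?mulr_gt0.
rewrite mulr_gt0 ?powR_gt0// ltr_pwDl//.
by rewrite divr_ge0// !mulr_ge0 ?exprn_ge0 ?mulr_ge0 ?(ltW eps0).
Qed.

Let pow2_lt1 : 2 `^ (- al) < 1 :> R.
Proof.
rewrite powRN invf_lt1 ?powR_gt0//.
have := @gt0_ltr_powR R al al_gt0 1 2; rewrite powR1; apply; rewrite ?nnegrE//; lra.
Qed.

Lemma osc_const_gt0 : 0 < osc_const.
Proof. by rewrite divr_gt0 ?pair_const_gt0// subr_gt0. Qed.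

(** The fixed-point identity that closes the induction in [osc_iter]: halving the radius multiplies
    the old bound by 2^(-al), and one step adds [pair_const]. *)
Let osc_constE : pair_const + osc_const * 2 `^ (- al) = osc_const.
Proof.
by rewrite /osc_const; field; rewrite gt_eqF// subr_gt0.
Qed.

Variables (u : V -> R) (g : R).
Hypothesis cu : continuous u.
Hypothesis g0 : 0 < g.
Hypothesis ug : (gagliardo_energy q s p u <= (g `^ p)%:E)%E.

Let um : measurable_fun setT u. Proof. exact: continuous_measurable_rV. Qed.

Let muc x r : 0 < r -> mu (cell G eps x r) = (m r)%:E.
Proof. by move=> r0; rewrite mu_cell ?ltW. Qed.

(** The range of [rho] serves both comparisons: concentric cells of radii [r] and [r / 2], and cells
    of equal radius about two points at distance [r]. *)
Lemma cell_pair_bound x y r rho : 0 < r -> r / 2 <= rho -> rho <= r -> d x y <= r ->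
  (\int[mu \x mu]_(z in cell G eps x r `*` cell G eps y rho) `|u z.1 - u z.2|%:E <=
   (m r * m rho * (pair_const * g * r `^ al))%:E)%E.
Proof.
move=> r0 rho1 rho2 dxy.
have rho0 : 0 < rho by rewrite (lt_le_trans _ rho1)// divr_gt0.
have e2 : 0 < (2 * eps) ^+ n by rewrite exprn_gt0 ?mulr_gt0.
apply: (le_trans (@pair_integral_bound _ _ _ G q s p p1 Qps u _ _ (m r) (m rho) (3 * r) g
   _ _ _ _ _ _ g0 _ ug)) => //.
- exact: measurable_cell.
- exact: measurable_cell.
- exact: muc.
- exact: muc.
- by rewrite mulr_gt0.
- move=> z w zx wy.
  have h1 := cell_d r0 zx.
  have h2 := cell_d rho0 wy.
  have h3 := hn_triangle q z x w.
  have h4 := hn_triangle q x y w.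
  have h5 := hdistC q w y.
  lra.
rewrite lee_fin powRM ?(ltW r0)//.
rewrite (_ : m r * m rho * (pair_const * g * r `^ al) =
  g * (3 `^ al * r `^ al) * (m r * m rho + r ^+ hd * rho ^+ hd * 3 ^+ (2 * hd) * 2 ^+ hd)).
  rewrite ler_pM2l; last by rewrite !mulr_gt0 ?powR_gt0.
  rewrite lerD2l exprMn mulnC exprM (exprM r) expr2 (expr2 (r ^+ hd)).
  (* Trades one of the two factors r^Q of (3r)^(2Q) for rho^Q, so that the product of the cell
     measures appears. *)
  have : r ^+ hd <= 2 ^+ hd * rho ^+ hd.
    by rewrite -exprMn lerXn2r ?nnegrE ?mulr_ge0 ?(ltW r0) ?(ltW rho0)//; lra.
  have : 0 <= r ^+ hd * (3 ^+ hd * 3 ^+ hd) by rewrite !mulr_ge0 ?exprn_ge0 ?(ltW r0).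
  move: (r ^+ hd) (rho ^+ hd) (3 ^+ hd * _) (2 ^+ hd) => a b c e h1 h2.
  have := ler_wpM2l h1 h2; lra.
rewrite /pair_const; field.
by rewrite ?expf_neq0// ?mulf_neq0// ?gt_eqF.
Qed.

(** Left unnormalized: the mean oscillation is this integral over [m r], so the bounds below carry
    the factor [m r]. *)
Definition osc x r : \bar R := (\int[mu]_(z in cell G eps x r) `|u z - u x|%:E)%E.

Let mosc x : measurable_fun setT (fun z => `|u z - u x|).
Proof. by apply: measurableT_comp => //; exact: measurable_funB. Qed.

Lemma osc_step x r K : 0 < r -> (osc x (r / 2) <= (m (r / 2) * K)%:E)%E ->
  (osc x r <= (m r * (pair_const * g * r `^ al + K))%:E)%E.
Proof.
move=> r0 hK; have r20 : 0 < r / 2 by rewrite divr_gt0.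
have mr2 := m_gt0 r20.
rewrite -(@lee_pmul2r _ (m (r / 2))%:E)// -EFinM -(muc x r20).
have mc r' : measurable (cell G eps x r') by exact: measurable_cell.
rewrite -(integral_setX_fst mu mu)//.
(* Both sides were multiplied by the measure of the smaller cell, so a point w of that cell can be
   averaged in between: |u z - u x| <= |u z - u w| + |u w - u x|. *)
apply: (@le_trans _ _ (\int[mu \x mu]_(z in cell G eps x r `*` cell G eps x (r / 2))
   (`|u z.1 - u z.2| + `|u z.2 - u x|)%:E)%E).
  apply: ge0_integral_le => //.
  - exact: measurableX.
  - exact: (measurableT_comp (mosc x) measurable_fst).
  - apply: measurable_funD; first exact: measurable_diff.
    exact: (measurableT_comp (mosc x) measurable_snd).
  - by move=> z _; rewrite normr_ge0 /= ler_distD.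
rewrite ge0_integral_addE//; last 3 first.
- exact: measurableX.
- exact: measurable_diff.
- exact: (measurableT_comp (mosc x) measurable_snd).
rewrite (integral_setX_snd mu mu _ _ (mosc x))// muc//.
rewrite (_ : m r * _ * m (r / 2) = m r * m (r / 2) * (pair_const * g * r `^ al) +
   m r * (m (r / 2) * K)); last by ring.
rewrite EFinD leeD//; last by rewrite [leRHS]EFinM lee_pmul2l// lte_fin m_gt0.
apply: cell_pair_bound => //; last by rewrite hdistxx ltW.
by rewrite ler_pdivrMr// ler_peMr ?ltW// ltr1n.
Qed.

(** Induction from the small cell upwards. The accumulated errors stay below [osc_const] for every
    [i], so [i] may be chosen after [eta]. *)
Lemma osc_iter x eta i r : 0 < r -> 0 <= eta ->
  (forall z, cell G eps x (r / 2 ^+ i) z -> `|u z - u x| <= eta) ->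
  (osc x r <= (m r * (eta + osc_const * g * r `^ al))%:E)%E.
Proof.
move=> + eta0; elim: i r => [|i IH] r r0 h.
  apply: (@le_trans _ _ (\int[mu]_(z in cell G eps x r) eta%:E)%E).
    apply: ge0_integral_le => //; first exact: measurable_cell.
    by move=> z hz; rewrite normr_ge0 /= h// expr0 divr1.
  rewrite (integral_cst mu (measurable_cell G eps x r) eta%:E).
  have -> : (eta%:E * mu (cell G eps x r) = (m r * eta)%:E)%E.
    by rewrite muc// -EFinM mulrC.
  rewrite lee_fin ler_pM2l ?m_gt0// lerDl.
  apply: mulr_ge0; last exact: powR_ge0.
  by apply: mulr_ge0; [exact: (ltW osc_const_gt0)|exact: ltW].
have r20 : 0 < r / 2 by rewrite divr_gt0.
have := IH _ r20; rewrite -mulrA -invfM -exprS => /(_ h) /(osc_step r0).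
move=> /le_trans; apply; rewrite lee_fin ler_pM2l ?m_gt0//.
rewrite powRM ?invr_ge0 ?(ltW r0)// -[2^-1](powR_inv1) // -powRrM mulN1r.
rewrite -[in leRHS]osc_constE; lra.
Qed.

Lemma osc_bound x r : 0 < r -> (osc x r <= (m r * (osc_const * g * r `^ al))%:E)%E.
Proof.
move=> r0; apply/lee_addgt0Pr => e e0.
(* This [eta] costs exactly [e] once multiplied by [m r]; continuity provides a cell on which it is
   valid, reached after [i] halvings. *)
have eta0 : 0 < e / m r by rewrite divr_gt0 ?m_gt0.
have /cvgrPdist_le/(_ _ eta0)/cell_nbhs[r1 r10 h] := @cu x.
have r1r : 0 < r1 / r by rewrite divr_gt0.
have [i _ /(_ i (leqnn _)) hi] := near_infty_natSinv_expn_lt (PosNum r1r).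
rewrite /= in hi.
have hz z : cell G eps x (r / 2 ^+ i) z -> `|u z - u x| <= e / m r.
  move=> hz; rewrite distrC; apply: (h (r / 2 ^+ i)) => //.
    by rewrite divr_gt0 ?exprn_gt0.
  by rewrite mulrC -ltr_pdivlMr// -div1r.
apply: (le_trans (osc_iter r0 (ltW eta0) hz)).
rewrite -EFinD lee_fin mulrDr [leLHS]addrC lerD2l mulrC divfK//.
by rewrite gt_eqF ?m_gt0.
Qed.

(** At scale r = d(x, y), pass from [x] to [y] through a point of each cell of radius [r]; the three
    averaged differences give the three summands of the constant. *)
Lemma morrey_holder x y :
  `|u x - u y| <= (osc_const + pair_const + osc_const) * g * d x y `^ al.
Proof.
have [dxy0|dxy0] := eqVneq (d x y) 0.
  by rewrite (hdist_eq0 dxy0) subrr normr0 hdistxx powR0 ?mulr0 ?gt_eqF ?al_gt0.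
have r0 : 0 < d x y by rewrite lt_neqAle eq_sym dxy0 hdist_ge0.
set r := d x y in r0 *.
have mr := m_gt0 r0.
set X := cell G eps x r; set Y := cell G eps y r.
have mX : measurable X by exact: measurable_cell.
have mY : measurable Y by exact: measurable_cell.
have mXY : measurable (X `*` Y) by exact: measurableX.
have m1 := measurableT_comp (mosc x) (@measurable_fst _ _ V V).
have m2 := measurableT_comp (mosc y) (@measurable_snd _ _ V V).
have m3 := measurable_diff um.
have mm : 0 < m r * m r by exact: mulr_gt0.
rewrite -(ler_pM2r mm) -lee_fin.
have PXY : (mu \x mu)%E (X `*` Y) = (m r * m r)%:E.
  by rewrite product_measure1E// EFinM; congr (_ * _)%E; exact: muc.
rewrite EFinM -PXY -(integral_cst (mu \x mu)%E mXY `|u x - u y|%:E).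
apply: (@le_trans _ _ (\int[mu \x mu]_(z in X `*` Y)
   (`|u z.1 - u x| + (`|u z.1 - u z.2| + `|u z.2 - u y|))%:E)%E).
  apply: ge0_integral_le => //.
    by apply: measurable_funD => //; apply: measurable_funD.
  move=> z _; rewrite normr_ge0 /=.
  rewrite (le_trans (ler_distD (u z.1) _ _))// distrC lerD2l.
  exact: ler_distD.
have m4 := measurable_funD m3 m2.
rewrite (ge0_integral_addE _ mXY m1 m4); last 2 first.
- by move=> z /=.
- by move=> z; rewrite /= addr_ge0.
rewrite (ge0_integral_addE _ mXY m3 m2); last 2 first.
- by move=> z /=.
- by move=> z /=.
rewrite (integral_setX_fst mu mu _ _ (mosc x))// (integral_setX_snd mu mu _ _ (mosc y))//.
rewrite muc// muc//.
rewrite (_ : _ * (m r * m r) = (m r * (osc_const * g * r `^ al)) * m r +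
   (m r * m r * (pair_const * g * r `^ al) + m r * (m r * (osc_const * g * r `^ al))));
  last by ring.
rewrite !EFinD; apply: leeD; last apply: leeD.
- by rewrite [leRHS]EFinM lee_pmul2r// osc_bound.
- apply: cell_pair_bound => //.
  by rewrite ler_pdivrMr// ler_peMr ?ltW// ltr1n.
- by rewrite [leRHS]EFinM lee_pmul2l// osc_bound.
Qed.

(** Average over the unit cell: the oscillation gives [osc_const], and Young at threshold [g] bounds
    the integral of |u| by g m(1) + g, whence 1 and the inverse of m(1) = [(2 * eps) ^+ n]. *)
Lemma morrey_sup x : (\int[mu]_z (`|u z| `^ p)%:E <= (g `^ p)%:E)%E ->
  `|u x| <= (osc_const + 1 + ((2 * eps) ^+ n)^-1) * g.
Proof.
move=> hp.
have mr := m_gt0 (ltr01 : 0 < 1 :> R).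
set X := cell G eps x 1.
have mX : measurable X by exact: measurable_cell.
have mn : measurable_fun setT (fun z => `|u z|) by exact: measurableT_comp.
rewrite -(ler_pM2r mr) -lee_fin.
rewrite EFinM -(muc x ltr01) -(integral_cst mu mX `|u x|%:E).
apply: (@le_trans _ _ (\int[mu]_(z in X) (`|u z - u x| + `|u z|)%:E)%E).
  apply: ge0_integral_le => //; first exact: measurable_funD.
  move=> z _; rewrite normr_ge0 /= distrC -[in leLHS](subrK (u z) (u x)).
  exact: ler_normD.
rewrite ge0_integral_addE//.
rewrite (_ : _ * m 1 = m 1 * (osc_const * g * 1 `^ al) + (g * m 1 + g `^ (1 - p) * g `^ p)).
  rewrite EFinD leeD//; first exact: osc_bound.
  apply: integral_Young => //; first exact: muc.
  apply: le_trans hp; apply: ge0_subset_integral => //.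
  by apply/measurable_EFinP; exact: measurableT_comp (measurable_powR p) mn.
rewrite -powRD ?(gt_eqF g0) ?implybT// subrK (powRr1 (ltW g0)) powR1 expr1n.
by field; rewrite ?expf_neq0// ?mulf_neq0// ?gt_eqF.
Qed.

End morrey.

(** * Representatives of the elements of X_0 *)

Section powR_integrals.
Context d (T : measurableType d) (R : realType) (P : {measure set T -> \bar R}).

(** The sum is at most twice its larger term; [h] is the case where the first term is the larger. *)
Lemma powR_le_addn (p a b c : R) : 1 <= p -> 0 <= a -> 0 <= b -> 0 <= c -> a <= b + c ->
  a `^ p <= 2 `^ p * (b `^ p + c `^ p).
Proof.
move=> p1 a0 b0 c0 abc; have p0 : 0 <= p by exact: le_trans p1.
have h (x y : R) : 0 <= y -> y <= x -> (x + y) `^ p <= 2 `^ p * (x `^ p + y `^ p).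
  move=> y0 yx; have x0 := le_trans y0 yx.
  apply: (@le_trans _ _ ((2 * x) `^ p)).
    by apply: ge0_ler_powR; rewrite ?nnegrE ?addr_ge0 ?mulr_ge0//; lra.
  by rewrite powRM// ler_wpM2l ?powR_ge0// lerDl powR_ge0.
apply: (@le_trans _ _ ((b + c) `^ p)).
  by apply: ge0_ler_powR; rewrite ?nnegrE ?addr_ge0.
have [bc|/ltW cb] := leP b c; last exact: h.
by rewrite addrC [X in _ * X]addrC h.
Qed.

(** The weight [w] lets one statement serve the L^p integral (w = 1) and the energy (an inverse
    power of the distance). The factor 4 suffices because 2 * 2^p <= 4^p for p >= 1. *)
Lemma integral_powR_le (D : set T) (w f f1 f2 : T -> R) (p g : R) :
  1 <= p -> 0 < g -> measurable D ->
  measurable_fun setT w -> measurable_fun setT f ->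
  measurable_fun setT f1 -> measurable_fun setT f2 ->
  (forall x, 0 <= w x) -> (forall x, 0 <= f x) -> (forall x, 0 <= f1 x) ->
  (forall x, 0 <= f2 x) ->
  (forall x, f x <= f1 x + f2 x) ->
  (\int[P]_(x in D) (f1 x `^ p * w x)%:E <= (g `^ p)%:E)%E ->
  (\int[P]_(x in D) (f2 x `^ p * w x)%:E <= (g `^ p)%:E)%E ->
  (\int[P]_(x in D) (f x `^ p * w x)%:E <= ((4 * g) `^ p)%:E)%E.
Proof.
move=> p1 g0 mD mw mf m1 m2 w0 f0 f10 f20 fle i1 i2.
have mk (h : T -> R) : measurable_fun setT h ->
    measurable_fun setT (fun x => h x `^ p * w x).
  move=> mh; apply: measurable_funM => //.
  exact: measurableT_comp (measurable_powR p) mh.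
have k0 (h : T -> R) x : 0 <= h x `^ p * w x by rewrite mulr_ge0 ?powR_ge0.
apply: (@le_trans _ _ (\int[P]_(x in D)
    (2 `^ p * (f1 x `^ p * w x + f2 x `^ p * w x))%:E)%E).
  apply: ge0_integral_le => //; first exact: mk.
    by apply: measurable_funM => //; apply: measurable_funD; exact: mk.
  by move=> x _; rewrite k0 /= -mulrDl mulrA ler_wpM2r// powR_le_addn.
rewrite ge0_integral_scaleE ?powR_ge0//; last 2 first.
- by apply: measurable_funD; exact: mk.
- by move=> x; rewrite addr_ge0.
rewrite ge0_integral_addE//; last 2 first.
- exact: mk.
- exact: mk.
apply: (@le_trans _ _ ((2 `^ p)%:E * ((g `^ p)%:E + (g `^ p)%:E))%E).
  by rewrite lee_pmul2l ?lte_fin ?powR_gt0// leeD.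
rewrite -EFinD -EFinM lee_fin.
rewrite (_ : 4 * g = 2 * (2 * g)); last by ring.
rewrite (powRM _ (ler0n _ _)) ?mulr_ge0 ?(ltW g0)// ler_pM2l ?powR_gt0//.
rewrite powRM ?(ltW g0)// -mulr2n -[leLHS]mulr_natl ler_pM2r ?powR_gt0//.
by rewrite le1r_powR// ler1n.
Qed.

End powR_integrals.

Section ereal_seq.
Variable R : realType.

Lemma ereal_cvg0_lt (a : nat -> \bar R) (g : R) : a @ \oo --> 0%E -> 0 < g ->
  \forall j \near \oo, (a j < g%:E)%E.
Proof.
move=> a0 g0.
have : nbhs (0%E : \bar R) [set x | (x < g%:E)%E].
  by apply: open_nbhs_nbhs; split; [exact: open_ereal_lt_ereal|rewrite /= lte_fin].
by move=> /a0.
Qed.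

Lemma ereal_cvg0 (a : nat -> \bar R) : (forall j, 0 <= a j)%E ->
  (forall e, 0 < e -> \forall j \near \oo, (a j <= e%:E)%E) -> a @ \oo --> 0%E.
Proof.
move=> a0 h; apply/fine_cvgP; split.
  apply: filterS (h 1 ltr01) => j aj.
  by rewrite ge0_fin_numE// (le_lt_trans aj)// ltry.
apply/cvgrPdist_le => e e0; apply: filterS (h e e0) => j /= aj.
rewrite sub0r normrN ger0_norm ?fine_ge0//.
by rewrite -lee_fin fineK// ge0_fin_numE// (le_lt_trans aj)// ltry.
Qed.

Lemma limn_einf_le (a : nat -> \bar R) (c : \bar R) :
  (\forall j \near \oo, (a j <= c)%E) -> (limn_einf a <= c)%E.
Proof.
move=> h; rewrite limn_einf_lim; apply: lime_le; first exact: is_cvg_einfs.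
apply: filterS h => j; apply: le_trans.
by apply: ereal_inf_lbound; exists j => /=.
Qed.

Lemma real_cauchy_cvg (a : nat -> R) :
  (forall e, 0 < e -> exists K, forall i j, (K <= i)%N -> (K <= j)%N -> `|a i - a j| <= e) ->
  cvgn a.
Proof.
move=> h; apply/cauchy_cvgP; apply/cauchy_exP => e e0.
have e20 : 0 < e / 2 by rewrite divr_gt0.
have [K hK] := h _ e20.
exists (a K); exists K => // j /= Kj; rewrite /ball /=.
by rewrite (le_lt_trans (hK _ _ _ _))//; lra.
Qed.

Lemma cvg_powR (T : Type) (F : set_system T) (FF : Filter F) (f : T -> R) (t p : R) :
  0 < p -> 0 <= t -> (forall x, 0 <= f x) -> f @ F --> t ->
  f x `^ p @[x --> F] --> t `^ p.
Proof.
(* Differentiability of the power settles t > 0; at t = 0 the threshold e^(1/p) is used directly. *)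
move=> p0; rewrite le_eqVlt => /predU1P[<-|t0] f0 ft; last first.
  have /derivable1_diffP/differentiable_continuous c : derivable (@powR R ^~ p) t 1.
    by apply: derivable_powR; rewrite in_itv /= t0.
  exact: (cvg_comp _ _ ft c).
rewrite powR0 ?gt_eqF//; apply/cvgrPdist_le => e e0.
have r0 : 0 < e `^ p^-1 by rewrite powR_gt0.
move/cvgrPdist_le: ft => /(_ _ r0); apply: filterS => x.
rewrite !sub0r !normrN !ger0_norm ?powR_ge0// => fx.
rewrite -[leRHS]powRr1 ?(ltW e0)// -(mulVf (lt0r_neq0 p0)) powRrM.
by apply: ge0_ler_powR; rewrite ?nnegrE ?powR_ge0//; exact: ltW.
Qed.

End ereal_seq.

Section X0_representative.
Variables (R : realType) (k : nat) (N : 'I_k -> nat).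
Local Notation n := (\sum_(i < k) N i)%N.
Local Notation V := 'rV[R]_n.
Local Notation mu := (lebesgue_rV R n).
Local Notation hd := (homogeneous_dim N).
Local Notation Q := (hd%:R : R).
Variables (G : stratified_group R N) (q : homogeneous_norm G) (s p : R).
Local Notation d := (hdist G q).
Local Notation al := ((s * p - Q) / p).
Hypothesis p1 : 1 <= p.
Hypothesis Qps : Q < p * s.
Variable Om : set V.
Hypothesis oOm : open Om.

Let mOm : measurable Om. Proof. exact: open_measurable_rV. Qed.

Lemma Lp_norm_le (f : V -> R) (g : R) : measurable_fun setT f -> 0 <= g ->
  (Lp_norm p%:E Om f <= g%:E)%E -> (\int[mu]_(x in Om) (`|f x| `^ p)%:E <= (g `^ p)%:E)%E.
Proof.
move=> mf g0; have p0 : 0 < p by exact: lt_le_trans p1.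
rewrite /Lp_norm unlock.
have -> : (\int[mu]_x (`|(EFin \o patch (fun=> 0%R) Om f) x| `^ p))%E =
          (\int[mu]_(x in Om) (`|f x| `^ p)%:E)%E.
  rewrite [RHS]integral_mkcond; apply: eq_integral => x _.
  rewrite /= !patchE; case: ifPn => _; first by rewrite -poweR_EFin.
  change ((`|0 : R| `^ p)%:E = 0%E :> \bar R).
  by rewrite normr0 powR0 ?gt_eqF.
set J := (\int[mu]_(x in Om) _)%E.
have J0 : (0 <= J)%E by apply: integral_ge0 => x _; rewrite lee_fin powR_ge0.
move=> Jg; rewrite -(poweRe1 J0) -(mulVf (lt0r_neq0 p0)) poweRrM -poweR_EFin.
apply: gt0_ler_poweR => //; first exact: ltW.
- by rewrite in_itv /= poweR_ge0 leey.
- by rewrite in_itv /= lee_fin g0 leey.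
Qed.

Lemma X0_norm_le (u : V -> R) (g : R) : measurable_fun setT u -> 0 <= g ->
  (X0_norm q s p Om u <= g%:E)%E ->
  (\int[mu]_(x in Om) (`|u x| `^ p)%:E <= (g `^ p)%:E)%E /\
  (gagliardo_energy q s p u <= (g `^ p)%:E)%E.
Proof.
move=> um g0 h.
have L0 : (0 <= Lp_norm p%:E Om u)%E by rewrite /Lp_norm Lnorm_ge0.
have G0 : (0 <= gagliardo q s p setT u)%E by exact: poweR_ge0.
split.
  by apply: Lp_norm_le => //; apply: le_trans h; rewrite leeDl.
by apply: gagliardo_energy_le => //; apply: le_trans h; rewrite leeDr.
Qed.

Lemma test_function_continuous (f : V -> R) : test_function Om f -> continuous f.
Proof. by move=> [/(_ 0%N)[]]. Qed.

Lemma test_function_out (f : V -> R) x : test_function Om f -> ~ Om x -> f x = 0.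
Proof.
move=> [_ _ h] nx; apply: contrapT => /eqP fx; apply: nx; apply: h.
exact: subset_closure.
Qed.

Lemma energy_le (w u v : V -> R) (g : R) : 0 < g ->
  measurable_fun setT w -> measurable_fun setT u -> measurable_fun setT v ->
  (forall x y, `|w x - w y| <= `|u x - u y| + `|v x - v y|) ->
  (gagliardo_energy q s p u <= (g `^ p)%:E)%E ->
  (gagliardo_energy q s p v <= (g `^ p)%:E)%E ->
  (gagliardo_energy q s p w <= ((4 * g) `^ p)%:E)%E.
Proof.
move=> g0 mw um mv h hu hv.
apply: (@integral_powR_le _ _ _ _ setT (fun z => (d z.1 z.2 `^ (Q + p * s))^-1)
  (fun z => `|w z.1 - w z.2|) (fun z => `|u z.1 - u z.2|) (fun z => `|v z.1 - v z.2|)) => //.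
- exact: measurable_weight.
- exact: measurable_diff.
- exact: measurable_diff.
- exact: measurable_diff.
- by move=> z; rewrite invr_ge0 powR_ge0.
Qed.

Lemma Lp_integral_le (w u v : V -> R) (g : R) : 0 < g ->
  measurable_fun setT w -> measurable_fun setT u -> measurable_fun setT v ->
  (forall x, `|w x| <= `|u x| + `|v x|) ->
  (\int[mu]_(x in Om) (`|u x| `^ p)%:E <= (g `^ p)%:E)%E ->
  (\int[mu]_(x in Om) (`|v x| `^ p)%:E <= (g `^ p)%:E)%E ->
  (\int[mu]_(x in Om) (`|w x| `^ p)%:E <= ((4 * g) `^ p)%:E)%E.
Proof.
move=> g0 mw um mv h hu hv.
have E (f : V -> R) : (\int[mu]_(x in Om) (`|f x| `^ p)%:E =
    \int[mu]_(x in Om) (`|f x| `^ p * cst 1 x)%:E)%E.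
  by apply: eq_integral => x _; rewrite mulr1.
rewrite E in hu; rewrite E in hv; rewrite E.
apply: (integral_powR_le p1 g0 mOm _ _ _ _ _ _ _ _ _ hu hv) => //;
  exact: measurableT_comp.
Qed.

(** Continuity is asked of [w] only, smallness only of two measurable functions dominating [w] and
    its differences. They will be [phi j - u] and [phi l - u] (Cauchy property), or [phi j - u] and
    [u] (bounds on the limit). *)
Lemma X0_morrey : exists2 C : R, 0 < C & forall (w f1 f2 : V -> R) (g : R), 0 < g ->
  continuous w -> (forall x, ~ Om x -> w x = 0) ->
  measurable_fun setT f1 -> measurable_fun setT f2 ->
  (forall x, `|w x| <= `|f1 x| + `|f2 x|) ->
  (forall x y, `|w x - w y| <= `|f1 x - f1 y| + `|f2 x - f2 y|) ->
  (X0_norm q s p Om f1 <= g%:E)%E -> (X0_norm q s p Om f2 <= g%:E)%E ->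
  (forall x, `|w x| <= C * g) /\ (forall x y, `|w x - w y| <= C * g * d x y `^ al).
Proof.
have [eps eps0 ceps] := cell_hdist q.
pose O := @osc_const R k N s p eps; pose W := @pair_const R k N s p eps.
have O0 : 0 < O by exact: osc_const_gt0.
have W0 : 0 < W by exact: pair_const_gt0.
pose E := ((2 * eps) ^+ n)^-1.
have E0 : 0 < E by rewrite invr_gt0 exprn_gt0 ?mulr_gt0.
(* The 4 is the loss in [integral_powR_le]; the sum dominates the constants of both Morrey
   estimates. *)
exists (4 * (O + W + O + 1 + E)); first by lra.
move=> w f1 f2 g g0 cw w0 mf1 mf2 h1 h2 b1 b2.
have [L1 G1] := X0_norm_le mf1 (ltW g0) b1.
have [L2 G2] := X0_norm_le mf2 (ltW g0) b2.
have mw : measurable_fun setT w by exact: continuous_measurable_rV.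
have Gw := energy_le g0 mw mf1 mf2 h2 G1 G2.
have Lw := Lp_integral_le g0 mw mf1 mf2 h1 L1 L2.
have p0 : 0 < p by exact: lt_le_trans p1.
have g40 : 0 < 4 * g by rewrite mulr_gt0.
(* Since [w] vanishes outside [Om], the integral extends to the whole group, as [morrey_sup]
   requires. *)
have {}Lw : (\int[mu]_x (`|w x| `^ p)%:E <= ((4 * g) `^ p)%:E)%E.
  apply: le_trans Lw; rewrite [leRHS]integral_mkcond.
  rewrite le_eqVlt; apply/orP; left; apply/eqP; apply: eq_integral => x _.
  rewrite patchE; case: ifPn => // /negP; rewrite inE => /w0 ->.
  by rewrite normr0 powR0 ?gt_eqF.
split=> [x|x y].
  apply: (le_trans (morrey_sup p1 Qps eps0 ceps cw g40 Gw x Lw)).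
  rewrite -/O -/E (_ : 4 * _ * g = (O + W + O + 1 + E) * (4 * g)); last by ring.
  rewrite ler_pM2r//; lra.
apply: (le_trans (morrey_holder p1 Qps eps0 ceps cw g40 Gw x y)).
rewrite ler_wpM2r ?powR_ge0// -/O -/W.
have : 0 <= g * (1 + E) by rewrite mulr_ge0 ?ltW//; lra.
lra.
Qed.

End X0_representative.

Section X0_limit.
Variables (R : realType) (k : nat) (N : 'I_k -> nat).
Local Notation n := (\sum_(i < k) N i)%N.
Local Notation V := 'rV[R]_n.
Local Notation mu := (lebesgue_rV R n).
Local Notation hd := (homogeneous_dim N).
Local Notation Q := (hd%:R : R).
Variables (G : stratified_group R N) (q : homogeneous_norm G) (s p : R).
Local Notation d := (hdist G q).
Local Notation al := ((s * p - Q) / p).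
Hypothesis p1 : 1 <= p.
Hypothesis Qps : Q < p * s.
Variable Om : set V.
Hypothesis oOm : open Om.

Let mOm : measurable Om. Proof. exact: open_measurable_rV. Qed.

Lemma holder_continuous (v : V -> R) (C : R) :
  (forall x y, `|v x - v y| <= C * d x y `^ al) -> continuous v.
Proof.
move=> hv x; apply/(@cvgrPdist_le _ _ _ (nbhs x) (nbhs_filter x)) => e e0.
have a0 := al_gt0 p1 Qps.
have C0 : 0 < `|C| + 1 by rewrite ltr_wpDl.
pose r := (e / (`|C| + 1)) `^ al^-1.
have r0 : 0 < r by rewrite powR_gt0// divr_gt0.
have /cvgrPdist_lt/(_ _ r0) nr := @hdist_cvg0 _ _ _ _ q x.
near=> y; have : `|0 - d y x| < r by near: y; exact: nr.
rewrite sub0r normrN ger0_norm ?hdist_ge0// => dr.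
apply: (le_trans (hv x y)); rewrite hdistC.
have h : d y x `^ al <= e / (`|C| + 1).
  have -> : e / (`|C| + 1) = r `^ al.
    by rewrite /r -powRrM mulVf ?lt0r_neq0// powRr1// divr_ge0 ?(ltW e0) ?(ltW C0).
  by apply: ge0_ler_powR; rewrite ?nnegrE ?powR_ge0 ?hdist_ge0//; exact: ltW.
apply: (@le_trans _ _ ((`|C| + 1) * d y x `^ al)).
  by rewrite ler_wpM2r ?powR_ge0// ler_wpDr// ler_norm.
by rewrite mulrC -ler_pdivlMr.
Unshelve. all: by end_near. Qed.

(** Bounds are given for every positive [g] above the norm, so a zero norm is no special case and
    [g] can later decrease to the norm. They hold on the whole group, not only on [Om]. *)
Lemma X0_bounded_representative : exists2 C : R, 0 < C & forall u, X0 q s p Om u ->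
  exists v : V -> R, representative Om u v /\
    forall g : R, 0 < g -> (X0_norm q s p Om u <= g%:E)%E ->
      (forall x, `|v x| <= C * g) /\ (forall x y, `|v x - v y| <= C * g * d x y `^ al).
Proof.
have [C C0 hC] := X0_morrey q p1 Qps oOm.
exists C => // u [[[um _] _] _ [phi [tphi cphi]]].
have cp j := test_function_continuous (tphi j).
have mp j : measurable_fun setT (phi j) by exact: continuous_measurable_rV.
have md j : measurable_fun setT (fun x => phi j x - u x) by exact: measurable_funB.
have dist j l g : 0 < g -> (X0_norm q s p Om (fun x => phi j x - u x)%R <= g%:E)%E ->
    (X0_norm q s p Om (fun x => phi l x - u x)%R <= g%:E)%E ->
    forall x, `|phi j x - phi l x| <= C * g.
  move=> g0 hj hl x.
  have := hC (fun x => phi j x - phi l x) _ _ g g0 _ _ (md j) (md l) _ _ hj hl.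
  move=> h; apply: (h _ _ _ _).1 => {h x} [x|x nx|x|x y].
  - by apply: continuousB; exact: cp.
  - by rewrite !(test_function_out _ nx)// subrr.
  - by rewrite -[in leLHS](subrKA (u x)) -[X in _ + `|X|]opprB normrN; exact: ler_normD.
  - rewrite (_ : _ - _ - _ = (phi j x - u x - (phi j y - u y)) -
      (phi l x - u x - (phi l y - u y))); last by ring.
    exact: ler_normB.
have cvgphi x : cvgn (fun j => phi j x).
  apply: real_cauchy_cvg => e e0.
  have eC : 0 < e / C by rewrite divr_gt0.
  have [K _ hK] := ereal_cvg0_lt cphi eC.
  exists K => i j Ki Kj.
  have := dist i j _ eC (ltW (hK _ Ki)) (ltW (hK _ Kj)) x.
  by rewrite mulrC divfK// gt_eqF.
pose v x := limn (fun j => phi j x).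
have phiv x : phi j x @[j --> \oo] --> v x by exact: cvgphi.
exists v; split; last first.
  move=> g g0 ug.
  (* For large [j] both [phi j - u] and [u] have norm at most [g], so [phi j] already obeys the
     bounds, which survive the pointwise limit. *)
  have near_phi : \forall j \near \oo, (forall x, `|phi j x| <= C * g) /\
      (forall x y, `|phi j x - phi j y| <= C * g * d x y `^ al).
    have := ereal_cvg0_lt cphi g0; apply: filterS => j /ltW hj.
    apply: (hC (phi j) _ _ g g0 _ _ (md j) um _ _ hj ug) => [|x nx|x|x y].
    - exact: cp.
    - exact: test_function_out (tphi j) nx.
    - by rewrite -[in leLHS](subrK (u x) (phi j x)); exact: ler_normD.
    - rewrite (_ : phi j x - phi j y = (phi j x - u x - (phi j y - u y)) + (u x - u y)).
        exact: ler_normD.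
      by ring.
  split=> [x|x y].
    apply: (cvgr_to_le (cvg_norm (phiv x))).
    by apply: filterS near_phi => j [hj _]; exact: hj.
  apply: (cvgr_to_le (cvg_norm (cvgB (phiv x) (phiv y)))).
  by apply: filterS near_phi => j [_ hj]; exact: hj.
pose f j x := (`|phi j x - u x| `^ p)%:E.
pose h x := (`|v x - u x| `^ p)%:E.
have mf j : measurable_fun Om (f j).
  apply/measurable_EFinP/measurable_funTS.
  apply: (measurableT_comp (measurable_powR p)); exact: measurableT_comp.
have flim x : f j x @[j --> \oo] --> h x.
  apply: cvg_EFin; first exact: nearW.
  have c1 : `|phi j x - u x| @[j --> \oo] --> `|v x - u x|.
    by apply: cvg_norm; apply: cvgB => //; exact: cvg_cst.
  by apply: cvg_powR c1; rewrite ?(lt_le_trans ltr01).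
have mh : measurable_fun Om h by apply: (emeasurable_fun_cvg f).
have h0 x : (0 <= h x)%E by rewrite lee_fin powR_ge0.
have int0 : (\int[mu]_(x in Om) `|h x| = 0)%E.
  under eq_integral do rewrite gee0_abs//.
  apply/eqP; rewrite eq_le integral_ge0// andbT; apply/lee_addgt0Pr => e e0.
  rewrite add0e.
  have p0 : 0 < p by exact: lt_le_trans p1.
  (* Norms below e^(1/p) make the integrals at most [e]; by Fatou the integral of |v - u|^p is then
     at most every positive [e]. *)
  have r0 : 0 < e `^ p^-1 by rewrite powR_gt0.
  under eq_integral do rewrite -(cvg_limn_einf_sup (flim _)).1.
  apply: le_trans (fatou mu mOm mf _) _.
    by move=> j x _; rewrite lee_fin powR_ge0.
  apply: limn_einf_le; have := ereal_cvg0_lt cphi r0; apply: filterS => j /ltW hj.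
  have := (X0_norm_le p1 (md j) (ltW r0) hj).1.
  by rewrite -powRrM mulVf ?gt_eqF// powRr1// ltW.
have := (ae_eq_integral_abs mu mOm mh).1 int0; apply: filterS => x hx Omx.
have /eqP := hx Omx; rewrite eqe => /eqP /powR_eq0_eq0 /eqP.
by rewrite normr_eq0 subr_eq0 => /eqP.
Qed.

End X0_limit.

(** * The embeddings *)

Section holder_norms.
Variables (R : realType) (k : nat) (N : 'I_k -> nat).
Local Notation n := (\sum_(i < k) N i)%N.
Local Notation V := 'rV[R]_n.
Local Notation mu := (lebesgue_rV R n).
Variables (G : stratified_group R N) (q : homogeneous_norm G).
Local Notation d := (hdist G q).
Variable Om : set V.

Lemma Lp_norm_inf_le (v : V -> R) (B : R) : 0 <= B ->
  (forall x, Om x -> `|v x| <= B) -> (Lp_norm +oo Om v <= B%:E)%E.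
Proof.
move=> B0 h; rewrite /Lp_norm unlock; case: ifPn => _; last by rewrite lee_fin.
apply/ess_supP; apply: filterE => x /=; rewrite patchE.
case: ifPn => [|_]; first by rewrite inE lee_fin; exact: h.
by rewrite lee_fin normr0.
Qed.

(** Cut at distance [delta]: near pairs gain the power [al - be] from the [al]-bound, far pairs use
    the sup bound. [delta = 1] yields membership and the embedding, a [delta] depending on the error
    yields convergence. *)
Lemma holder_norm_le (v : V -> R) (B H al be delta : R) :
  0 <= B -> 0 <= H -> 0 < delta -> 0 <= be -> be <= al ->
  (forall x, Om x -> `|v x| <= B) ->
  (forall x y, Om x -> Om y -> `|v x - v y| <= H * d x y `^ al) ->
  (holder_seminorm q be Om v <=
    (H * delta `^ (al - be) + (B + B) * delta `^ (- be))%:E)%E /\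
  (holder_norm q be Om v <=
    (B + (H * delta `^ (al - be) + (B + B) * delta `^ (- be)))%:E)%E.
Proof.
move=> B0 H0 d0 be0 beal hB hH.
have sem : (holder_seminorm q be Om v <=
    (H * delta `^ (al - be) + (B + B) * delta `^ (- be))%:E)%E.
  have t1 : 0 <= H * delta `^ (al - be) by rewrite mulr_ge0 ?powR_ge0.
  have t2 : 0 <= (B + B) * delta `^ (- be) by rewrite mulr_ge0 ?powR_ge0 ?addr_ge0.
  rewrite /holder_seminorm ge_max; apply/andP; split.
    by rewrite lee_fin addr_ge0.
  apply: ge_ereal_sup => _ [x [y [Ox Oy xy ->]]]; rewrite lee_fin.
  have r0 : 0 < d x y.
    rewrite lt_neqAle hdist_ge0 andbT eq_sym; apply/eqP => /hdist_eq0 e.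
    by rewrite e eqxx in xy.
  have [rd|rd] := leP (d x y) delta.
    apply: (@le_trans _ _ (H * delta `^ (al - be))); last by rewrite lerDl.
    rewrite ler_pdivrMr ?powR_gt0//; apply: (le_trans (hH _ _ Ox Oy)).
    rewrite -mulrA ler_wpM2l//.
    have {1}-> : al = (al - be) + be by rewrite subrK.
    rewrite powRD ?(gt_eqF r0) ?implybT// ler_wpM2r ?powR_ge0//.
    by apply: ge0_ler_powR; rewrite ?nnegrE ?subr_ge0 ?(ltW r0) ?(ltW d0).
  apply: (@le_trans _ _ ((B + B) * delta `^ (- be))); last by rewrite lerDr.
  rewrite ler_pdivrMr ?powR_gt0//.
  apply: (@le_trans _ _ (B + B)).
    by rewrite (le_trans (ler_normB _ _))// lerD// hB.
  rewrite -mulrA ler_peMr ?addr_ge0// powRN mulrC ler_pdivlMr ?powR_gt0// mul1r.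
  by apply: ge0_ler_powR; rewrite ?nnegrE ?(ltW r0) ?(ltW d0) ?(ltW rd).
by split=> //; rewrite /holder_norm EFinD leeD// Lp_norm_inf_le.
Qed.

Lemma ball_positive (x : V) (e : R) : 0 < e -> (0 < mu (ball x e))%E.
Proof.
move=> e0; pose a i := x ord0 i - e / 2; pose b i := x ord0 i + e / 2.
have ab i : a i <= b i by rewrite /a /b; lra.
apply: (@lt_le_trans _ _ (mu [set y : V | forall i, y ord0 i \in `[a i, b i]])).
  rewrite lebesgue_rV_box// lte_fin prodr_gt0// => i _; rewrite /a /b; lra.
have hb : [set y : V | forall i, y ord0 i \in `[a i, b i]] `<=` ball x e.
  move=> y h; split=> // i j; rewrite (ord1 i); have := h j.
  by rewrite in_itv /= /ball /= /a /b => /andP[h1 h2]; rewrite ltr_distlC; lra.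
apply: le_measure => //; rewrite inE; last exact: measurable_rV_ball.
rewrite (_ : [set y | _] = \bigcap_(i in [set: 'I_n])
    (@rV_coord R n i @^-1` `[a i, b i]%classic)); last first.
  by apply/seteqP; split => y /= h i => [_|]; [exact: h|exact: (h i I)].
apply: fin_bigcap_measurable => // i _.
by rewrite -[X in measurable X]setTI; exact: measurable_rV_coord.
Qed.

(** A null set contains no ball. The compactness clause concerns arbitrary representatives [v n],
    and this identifies them everywhere on [Om] with those carrying the estimates. *)
Lemma ae_continuous_eq (v w : V -> R) : open Om ->
  {within Om, continuous v} -> continuous w ->
  {ae mu, forall x, Om x -> v x = w x} -> forall x, Om x -> v x = w x.
Proof.
move=> oOm; rewrite continuous_open_subspace// => cv cw [A [mA A0 hA]] x Ox.
apply: contrapT => /eqP vw.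
have c : v y - w y @[y --> x] --> v x - w x.
  by apply: continuousB; [apply: cv; rewrite inE|exact: cw].
have vw0 : 0 < `|v x - w x| by rewrite normr_gt0 subr_eq0.
have nO : nbhs x Om by move: oOm; rewrite openE; exact.
have /cvgrPdist_lt/(_ _ vw0) nvw := c.
have /nbhs_ballP[e /= e0 he] : nbhs x (fun y => Om y /\
    `|v x - w x - (v y - w y)| < `|v x - w x|) by apply: filterI.
have := ball_positive x e0; rewrite ltNge -A0 => /negP; apply.
apply: le_measure; rewrite ?inE//; first exact: measurable_rV_ball.
move=> y /he [Oy h]; apply: hA => /= /(_ Oy) e'.
by move: h; rewrite e' subrr subr0 ltxx.
Qed.

End holder_norms.

(** * Compactness of bounded Holder families *)

Section compactness.
Variables (R : realType) (k : nat) (N : 'I_k -> nat).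
Local Notation n := (\sum_(i < k) N i)%N.
Local Notation V := 'rV[R]_n.
Variables (G : stratified_group R N) (q : homogeneous_norm G).
Local Notation d := (hdist G q).

(** A Tychonoff cluster point gives no subsequence by itself, only arbitrarily late indices close to
    [w0] on a prescribed finite set; equicontinuity does the rest. *)
Lemma pointwise_cluster (T : eqType) (w : nat -> T -> R) (B : R) :
  (forall j x, `|w j x| <= B) ->
  exists w0 : T -> R, forall (S : seq T) (e : R) (J : nat), 0 < e ->
    exists2 j, (J <= j)%N & forall x, x \in S -> `|w j x - w0 x| < e.
Proof.
move=> wB.
have := @tychonoff T (fun=> R) (fun=> `[- B, B]%classic) (fun=> @segment_compact R (- B) B).
move=> /(_ (w @ \oo) _) [|w0 [_ cw0]].
  by exists 0%N => // j _ x /=; rewrite in_itv /= -ler_norml; exact: wB.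
exists w0 => S e J e0.
have nS : nbhs (w0 : prod_topology (fun _ : T => R))
    [set f : prod_topology (fun _ : T => R) | forall x, x \in S -> `|f x - w0 x| < e].
  elim: S => [|x S IH]; first by apply: filterE => f.
  have nx : nbhs (w0 : prod_topology (fun _ : T => R))
      (@proj T (fun _ => R) x @^-1` ball (w0 x) e).
    apply: (@proj_continuous T (fun _ => R) x w0); exact: nbhsx_ballx.
  apply: (@filterS2 _ _ (@nbhs_filter (prod_topology (fun _ : T => R)) w0) _ _ _ _ nx IH).
  move=> f fx fS y; rewrite inE => /predU1P[->|]; last exact: fS.
  by rewrite distrC; exact: fx.
have wJ : (w @ \oo) [set f | exists2 j, (J <= j)%N & f = w j].
  by exists J => // j /= Jj; exists j.
by have [f [[j Jj ->] h]] := cw0 _ _ wJ nS; exists j.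
Qed.

(** Boundedness refers to the coordinate norm, so [Om] lies in a compact cube, which open [d]-balls
    cover. Their centres may fall outside [Om], hence the global estimates assumed in
    [holder_compact]. *)
Lemma finite_hnet (Om : set V) (delta : R) : bounded_set Om -> 0 < delta ->
  exists S : seq V, forall x, Om x -> exists2 y, y \in S & d x y < delta.
Proof.
move=> [M [_ hM]] d0.
have M1 : M < `|M| + 1 by rewrite (le_lt_trans (ler_norm M))// ltrDl.
pose A := [set v : V | forall i, v ord0 i \in `[- (`|M| + 1), `|M| + 1]].
have cA : compact A.
  apply: (@rV_compact _ _ (fun=> `[- (`|M| + 1), `|M| + 1]%classic)) => _.
  exact: segment_compact.
have OA : Om `<=` A.
  move=> x /(hM _ M1) xM i; rewrite in_itv /= -ler_norml; apply: le_trans xM.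
  rewrite [leRHS]/Num.norm /= mx_normrE; apply/bigmax_geP; right => /=.
  by exists (ord0, i).
move: cA; rewrite compact_cover => /(_ V setT (fun y => [set x | d x y < delta])) [||S _ hS].
- move=> y _; have c : continuous (fun x => d x y).
    move=> x; have c1 : (z, y) @[z --> x] --> ((x, y) : V * V).
      apply: (@cvg_pair _ _ _ (nbhs x) (nbhs x) (nbhs y) _ _ _ id (cst y)).
        exact: cvg_id.
      exact: cvg_cst.
    exact: (cvg_comp _ _ c1 (@hdist_continuous _ _ _ G q (x, y))).
  exact: (open_comp (fun z _ => c z) (@open_lt R delta)).
- by move=> x _; exists x => //=; rewrite hdistxx.
- by exists (finmap.enum_fset S) => x /OA /hS [y /= yS xy]; exists y.
Qed.

Lemma holder_compact (Om : set V) (w : nat -> V -> R) (B H al : R) :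
  bounded_set Om -> 0 < al -> 0 <= H ->
  (forall j x, `|w j x| <= B) ->
  (forall j x y, `|w j x - w j y| <= H * d x y `^ al) ->
  exists (sg : nat -> nat) (w0 : V -> R),
    [/\ {homo sg : i j / (i < j)%N}, (forall x, `|w0 x| <= B),
        (forall x y, `|w0 x - w0 y| <= H * d x y `^ al) &
        forall e, 0 < e -> \forall j \near \oo, forall x, Om x -> `|w (sg j) x - w0 x| <= e].
Proof.
move=> bOm al0 H0 wB wH.
have [w0 cw] := pointwise_cluster wB.
have w0B x : `|w0 x| <= B.
  apply/ler_addgt0Pr => e e0; have [j _ hj] := cw [:: x] e 0%N e0.
  have := hj x (mem_head _ _); have := wB j x.
  have := ler_normB (w j x) (w j x - w0 x); rewrite opprB addrC subrK; lra.
have w0H x y : `|w0 x - w0 y| <= H * d x y `^ al.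
  apply/ler_addgt0Pr => e e0; have e20 : 0 < e / 2 by rewrite divr_gt0.
  have [j _ hj] := cw [:: x; y] _ 0%N e20.
  have h1 := hj x (mem_head _ _); have h2 := hj y (mem_last x [:: y]).
  have h3 := wH j x y.
  have := ler_distD (w j x) (w0 x) (w0 y); have := ler_distD (w j y) (w j x) (w0 y).
  rewrite (distrC (w0 x) (w j x)); lra.
have unif e J : 0 < e -> exists2 j, (J <= j)%N & forall x, Om x -> `|w j x - w0 x| <= e.
  move=> e0; have e20 : 0 < e / 2 by rewrite divr_gt0.
  (* Within this radius both [w j] and [w0] vary by at most e / 4; with e / 2 at the net point the
     total is [e]. *)
  pose r := (e / 4 / (H + 1)) `^ al^-1.
  have H1 : 0 < H + 1 by rewrite ltr_wpDl.
  have r0 : 0 < r by rewrite powR_gt0// !divr_gt0.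
  have [S hS] := finite_hnet bOm r0.
  have [j Jj hj] := cw S _ J e20; exists j => // x Ox.
  have [y yS xy] := hS x Ox.
  have hd : H * d x y `^ al <= e / 4.
    apply: (@le_trans _ _ (H * r `^ al)).
      rewrite ler_wpM2l//.
      by apply: ge0_ler_powR; rewrite ?nnegrE ?hdist_ge0 ?(ltW al0) ?(ltW r0) ?(ltW xy).
    rewrite /r -powRrM mulVf ?gt_eqF// powRr1; last by rewrite !divr_ge0 ?ltW.
    rewrite (_ : H * _ = e / 4 * (H / (H + 1))); last by ring.
    by rewrite ler_piMr ?divr_ge0 ?(ltW e0)// ler_pdivrMr// mul1r lerDl.
  have h1 := wH j x y; have h2 := w0H x y; have h3 := hj y yS.
  have := ler_distD (w j y) (w j x) (w0 x); have := ler_distD (w0 y) (w j y) (w0 x).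
  rewrite (distrC (w0 y) (w0 x)); lra.
have /choice[c hc] : forall ij : nat * nat, exists j, (ij.2 <= j)%N /\
    forall x, Om x -> `|w j x - w0 x| <= ij.1.+1%:R^-1.
  move=> [i J]; have i0 : 0 < i.+1%:R^-1 :> R by rewrite invr_gt0.
  by have [j Jj hj] := unif _ J i0; exists j.
(* Each index is asked to exceed the previous one, with error at most 1/(i+1) at rank [i]. *)
pose sg := fix sg i := if i is i'.+1 then c (i, (sg i').+1) else c (0%N, 0%N).
exists sg, w0; split => //.
- by apply: homo_ltn => [i j l|i]; [exact: ltn_trans|exact: (hc (i.+1, (sg i).+1)).1].
- move=> e e0; have := near_infty_natSinv_lt (PosNum e0); apply: filterS => j /= je x Ox.
  apply: le_trans (ltW je); case: j {je} => [|j]; first exact: (hc (0%N, 0%N)).2.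
  exact: (hc (j.+1, (sg j).+1)).2.
Qed.

End compactness.

Section embeddings.
Variables (R : realType) (k : nat) (N : 'I_k -> nat).
Local Notation n := (\sum_(i < k) N i)%N.
Local Notation V := 'rV[R]_n.
Local Notation mu := (lebesgue_rV R n).
Local Notation Q := ((homogeneous_dim N)%:R : R).
Variables (G : stratified_group R N) (q : homogeneous_norm G) (s p : R).
Local Notation d := (hdist G q).
Local Notation al := ((s * p - Q) / p).
Hypothesis p1 : 1 <= p.
Hypothesis Qps : Q < p * s.
Variable Om : set V.
Hypothesis oOm : open Om.

Let mOm : measurable Om. Proof. exact: open_measurable_rV. Qed.

Lemma X0_norm_ge0 (u : V -> R) : (0 <= X0_norm q s p Om u)%E.
Proof. by rewrite adde_ge0 ?poweR_ge0// /Lp_norm Lnorm_ge0. Qed.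

Lemma X0_norm_fin (u : V -> R) : X0 q s p Om u -> X0_norm q s p Om u \is a fin_num.
Proof.
move=> [[[um Lu] gu] _ _]; rewrite ge0_fin_numE ?X0_norm_ge0//.
apply: lte_add_pinfty => //; apply: le_lt_trans Lu.
have p0 : 0 < p by exact: lt_le_trans p1.
have mpatch (D : set V) : measurable D ->
    measurable_fun setT (fun x => `|(EFin \o patch (fun=> 0%R) D u) x| `^ p)%E.
  move=> mD; rewrite (_ : (fun _ => _) = EFin \o (fun x => `|(u \_ D) x| `^ p)).
    have m1 : measurable_fun setT (u \_ D).
      have m0 : measurable_fun D u by exact: measurable_funTS.
      exact: (measurable_restrictT u mD).1.
    have m2 : measurable_fun setT (fun x => `|(u \_ D) x|) by exact: measurableT_comp.
    by apply/measurable_EFinP; exact: measurableT_comp (measurable_powR p) m2.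
  by apply/funext => x /=; rewrite -poweR_EFin.
rewrite /Lp_norm unlock; apply: gt0_ler_poweR; rewrite ?invr_ge0 ?(ltW p0)//.
- by rewrite in_itv /= leey andbT integral_ge0// => x _; exact: poweR_ge0.
- by rewrite in_itv /= leey andbT integral_ge0// => x _; exact: poweR_ge0.
apply: ge0_le_integral => //.
- by move=> x _; exact: poweR_ge0.
- exact: mpatch.
- exact: mpatch.
move=> x _; rewrite /= !patchE in_setT; case: ifPn => // _.
by rewrite lee_fin normr0 powR0 ?gt_eqF// powR_ge0.
Qed.

(** Allowing [be = al] serves the first embedding of the theorem, [be < al] the continuity half of
    compactness. The 4 counts one sup term and the three terms of the seminorm cut at
    [delta = 1]. *)
Lemma X0_continuously_embedded (be : R) : 0 < be -> be <= al ->
  continuously_embedded Om (X0 q s p Om) (X0_norm q s p Om)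
    (holder_closure q be Om) (holder_norm q be Om).
Proof.
move=> be0 beal.
have [C C0 hC] := X0_bounded_representative q p1 Qps oOm.
exists (4 * C); first by rewrite mulr_gt0.
move=> u Xu; have [v [rep hv]] := hC u Xu; exists v.
have Xf := X0_norm_fin Xu; have t0 := X0_norm_ge0 u.
set t := X0_norm q s p Om u in Xf t0 hv *.
have bound (g : R) : 0 < g -> (t <= g%:E)%E ->
    [/\ (Lp_norm +oo Om v <= (C * g)%:E)%E,
        (holder_seminorm q be Om v <= (3 * (C * g))%:E)%E &
        (holder_norm q be Om v <= (4 * C * g)%:E)%E].
  move=> g0 tg; have [h1 h2] := hv g g0 tg.
  have Cg : 0 <= C * g by rewrite mulr_ge0 ?ltW.
  have [] := @holder_norm_le _ _ _ _ q Om v (C * g) (C * g) al be 1 Cg Cg ltr01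
    (ltW be0) beal (fun x _ => h1 x) (fun x y _ _ => h2 x y).
  rewrite !powR1 !mulr1 => s1 s2; split.
  - exact: Lp_norm_inf_le.
  - by apply: le_trans s1 _; rewrite lee_fin; lra.
  - by apply: le_trans s2 _; rewrite lee_fin; lra.
have t1 : 0 < fine t + 1 by rewrite ltr_wpDl// fine_ge0.
have tt : (t <= (fine t + 1)%:E)%E by rewrite EFinD fineK// leeDl.
have [b1 b2 _] := bound _ t1 tt.
have [_ /(holder_continuous p1 Qps) cv] := hv _ t1 tt.
split => //.
- split; [split; [split|]|].
  + by apply: measurable_funTS; exact: continuous_measurable_rV.
  + by rewrite (le_lt_trans b1)// ltry.
  + by rewrite (le_lt_trans b2)// ltry.
  + exact: continuous_subspaceT.
- rewrite -(fineK Xf) -EFinM; apply/lee_addgt0Pr => e e0.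
  (* The norm may be 0, so the bound is applied slightly above it; the excess contributes exactly
     [e]. *)
  have g0 : 0 < fine t + e / (4 * C).
    by rewrite ltr_wpDl ?fine_ge0// divr_gt0// mulr_gt0.
  have [|_ _] := bound _ g0.
    by rewrite EFinD fineK// leeDl// lee_fin divr_ge0 ?mulr_ge0 ?ltW.
  rewrite mulrDr [X in _ + X]mulrC divfK -?EFinD//.
  by rewrite gt_eqF// mulr_gt0.
Qed.

Lemma X0_compactly_embedded (be : R) : bounded_set Om -> 0 < be -> be < al ->
  compactly_embedded Om (X0 q s p Om) (X0_norm q s p Om)
    (holder_closure q be Om) (holder_norm q be Om).
Proof.
move=> bOm be0 beal; split; first exact: X0_continuously_embedded (ltW beal).
move=> u v Xu [M hM] hv.
have [C C0 hC] := X0_bounded_representative q p1 Qps oOm.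
have a0 := al_gt0 p1 Qps.
pose g := `|M| + 1; have g0 : 0 < g by rewrite ltr_wpDl.
have Cg : 0 < C * g by rewrite mulr_gt0.
have /choice[w hw] : forall j, exists w : V -> R, [/\ representative Om (u j) w,
    (forall x, `|w x| <= C * g) & (forall x y, `|w x - w y| <= C * g * d x y `^ al)].
  move=> j; have [w [rw]] := hC _ (Xu j) => /(_ g g0) [|h1 h2]; last by exists w.
  apply: (le_trans (hM j)); rewrite lee_fin /g.
  by rewrite (le_trans (ler_norm _))// lerDl.
have vw j x : Om x -> v j x = w j x.
  have [[_ cv] rv] := hv j; have [rw _ hw2] := hw j.
  apply: (ae_continuous_eq oOm).
  - by apply: continuous_subspaceW cv; exact: subset_closure.
  - exact: (holder_continuous p1 Qps hw2).
  - by apply: filterS2 rv rw => y vy wy Oy; rewrite vy// wy.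
have [sg [w0 [sgm w0B w0H w0u]]] := holder_compact bOm a0 (ltW Cg)
  (fun j => let: And3 _ h _ := hw j in h) (fun j => let: And3 _ _ h := hw j in h).
have cw0 := holder_continuous p1 Qps w0H.
exists sg, w0; split => //.
  have [s1 _] := @holder_norm_le _ _ _ _ q Om w0 (C * g) (C * g) al be 1 (ltW Cg) (ltW Cg)
    ltr01 (ltW be0) (ltW beal) (fun x _ => w0B x) (fun x y _ _ => w0H x y).
  split; [split; [split|]|].
  + by apply: measurable_funTS; exact: continuous_measurable_rV.
  + by rewrite (le_lt_trans (Lp_norm_inf_le (ltW Cg) (fun x _ => w0B x)))// ltry.
  + by rewrite (le_lt_trans s1)// ltry.
  + exact: continuous_subspaceT.
apply: ereal_cvg0 => [j|e e0].
  by rewrite /holder_norm adde_ge0// ?le_max ?lexx// /Lp_norm Lnorm_ge0.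
have ab : 0 < al - be by rewrite subr_gt0.
pose H := C * g + C * g; have H0 : 0 < H by rewrite addr_gt0.
pose delta := (e / 2 / H) `^ (al - be)^-1.
have d0 : 0 < delta by rewrite powR_gt0// !divr_gt0.
have Hd : H * delta `^ (al - be) = e / 2.
  rewrite /delta -powRrM mulVf ?gt_eqF// powRr1 ?divr_ge0 ?(ltW e0) ?(ltW H0)//.
  by rewrite mulrC divfK// gt_eqF.
pose D := 1 + (delta `^ (- be) + delta `^ (- be)).
have D0 : 0 < D by rewrite ltr_pwDl// addr_ge0 ?powR_ge0.
pose e1 := e / 2 / D; have e10 : 0 < e1 by rewrite !divr_gt0.
apply: filterS (w0u e1 e10) => j hj.
have [|x y Ox Oy|_] := @holder_norm_le _ _ _ _ q Om (fun x => v (sg j) x - w0 x)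
    e1 H al be delta (ltW e10) (ltW H0) d0 (ltW be0) (ltW beal).
- by move=> x Ox; rewrite vw//; exact: hj.
- rewrite !vw//.
  have [_ _ hw2] := hw (sg j).
  rewrite (_ : _ - _ - _ = (w (sg j) x - w (sg j) y) - (w0 x - w0 y)); last by ring.
  by rewrite (le_trans (ler_normB _ _))// mulrDl lerD.
move=> /le_trans; apply; rewrite lee_fin Hd.
have : e1 * D = e / 2 by rewrite /e1 divfK// gt_eqF.
rewrite /D; lra.
Qed.

End embeddings.

Theorem theorem1p3 (R : realType) (k : nat) (N : 'I_k -> nat)
    (G : stratified_group R N) (q : homogeneous_norm G)
    (Om : set 'rV[R]_(\sum_(i < k) N i)) (s p : R) :
  open Om -> 0 < s -> s < 1 -> 1 <= p -> (homogeneous_dim N)%:R < p * s ->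
  let al := (s * p - (homogeneous_dim N)%:R) / p in
  continuously_embedded Om
    (X0 q s p Om) (X0_norm q s p Om)
    (holder q al Om) (holder_norm q al Om) /\
  (bounded_set Om -> forall be : R, 0 < be -> be < al ->
    compactly_embedded Om
      (X0 q s p Om) (X0_norm q s p Om)
      (holder_closure q be Om) (holder_norm q be Om)).
Proof.
move=> oOm _ _ p1 Qps al; split=> [|bOm be be0 beal].
  have [C C0 hC] := X0_continuously_embedded q p1 Qps oOm (al_gt0 p1 Qps) (lexx al).
  by exists C => // u /hC[v [[hv _] rep le]]; exists v.
exact: X0_compactly_embedded.
Qed.
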